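(* Let $n\ge 2$, let $\psi\in\mathcal{S}_1(\mathbb{R})$ be a non-trivial window (i.e. $\psi\not\equiv 0$) and let $\eta\in\mathcal{S}_1(\mathbb{R})$ be a reconstruction window for $\psi$. Then, as maps on the space of Lizorkin distributions, $$\frac{1}{C_{\psi,\eta}}\,DS_\eta^{*}\circ DS_\psi=\mathrm{Id}_{\mathcal{S}_0'(\mathbb{R}^n)}.$$
   Context: $\mathcal{S}(\mathbb{R}^d)$ is the Schwartz space of complex-valued functions with its usual topology. The Lizorkin space $\mathcal{S}_0(\mathbb{R}^d)$ consists of all $\varphi\in\mathcal{S}(\mathbb{R}^d)$ with $\int_{\mathbb{R}^d}\mathbf{x}^m\varphi(\mathbf{x})\,d\mathbf{x}=0$ for all multi-indices $m\in\mathbb{N}_0^d$, with the topology inherited from $\mathcal{S}(\mathbb{R}^d)$. $\mathcal{S}_1(\mathbb{R})=\{\varphi\in\mathcal{S}(\mathbb{R}):\ e^{ix}\varphi(x)\in\mathcal{S}_0(\mathbb{R})\}$. The Fourier transform is $\widehat{g}(\xi)=\int_{\mathbb{R}} g(x)e^{-ix\xi}\,dx$. A function $\eta\in\mathcal{S}(\mathbb{R})$ is a reconstruction window for a non-trivial $\psi\in\mathcal{S}(\mathbb{R})$ if $$C_{\psi,\eta}=\frac{1}{\pi}\int_{\mathbb{R}}\overline{\widehat{\psi}(\xi-1)}\,\widehat{\eta}(\xi-1)\,\frac{d\xi}{|\xi|^n}$$ is nonzero and finite. $\mathbb{R}^\times=\mathbb{R}\setminus\{0\}$ and $\mathbb{Y}^{n+1}=\mathbb{S}^{n-1}\times\mathbb{R}\times\mathbb{R}^\times$,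 where $\mathbb{S}^{n-1}$ is the unit sphere of $\mathbb{R}^n$ with surface measure $d\mathbf{u}$. $\mathcal{S}(\mathbb{Y}^{n+1})$ is the space of all $\Phi\in C^\infty(\mathbb{Y}^{n+1})$ such that $$\rho_{s,r}^{l,m,k}(\Phi)=\sup_{(\mathbf{u},b,a)\in\mathbb{Y}^{n+1}}(1+|b|^2)^{r/2}(|a|^s+|a|^{-s})\,|\partial_a^l\partial_b^m\Delta_{\mathbf{u}}^k\Phi(\mathbf{u},b,a)|<\infty$$ for all $s,r,l,m,k\in\mathbb{N}_0$, where $\Delta_{\mathbf{u}}$ is the Laplace–Beltrami operator on $\mathbb{S}^{n-1}$, with the topology given by these seminorms. $\mathcal{S}_0'(\mathbb{R}^n)$ (Lizorkin distributions) and $\mathcal{S}'(\mathbb{Y}^{n+1})$ are the topological duals of $\mathcal{S}_0(\mathbb{R}^n)$ and $\mathcal{S}(\mathbb{Y}^{n+1})$; $\langle\cdot,\cdot\rangle$ is the (bilinear) dual pairing. On test functions: with $\psi_{\mathbf{u},b,a}(\mathbf{x})=\frac{|a|}{(2\pi)^{n/2}}\psi\big(a(\mathbf{x}\cdot\mathbf{u}-b)\big)e^{ia(\mathbf{x}\cdot\mathbf{u})}$, $$DS_\psi\varphi(\mathbf{u},b,a)=\int_{\mathbb{R}^n}\varphi(\mathbf{x})\overline{\psi_{\mathbf{u},b,a}(\mathbf{x})}\,d\mathbf{x}\quad(\varphi\in\mathcal{S}_0(\mathbb{R}^n)),$$ $$DS_\psi^{*}\Phi(\mathbf{x})=\int_{\mathbb{S}^{n-1}}\int_{\mathbb{R}^\times}\int_{\mathbb{R}}\Phi(\mathbf{u},b,a)\psi_{\mathbf{u},b,a}(\mathbf{x})|a|^{n-2}\,db\,da\,d\mathbf{u}\quad(\Phi\in\mathcal{S}(\mathbb{Y}^{n+1})).$$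 For $\psi\in\mathcal{S}_1(\mathbb{R})$ these map continuously $\mathcal{S}_0(\mathbb{R}^n)\to\mathcal{S}(\mathbb{Y}^{n+1})$ and $\mathcal{S}(\mathbb{Y}^{n+1})\to\mathcal{S}_0(\mathbb{R}^n)$ respectively. On distributions (for $\psi\in\mathcal{S}_1(\mathbb{R})$): for $f\in\mathcal{S}_0'(\mathbb{R}^n)$, $DS_\psi f\in\mathcal{S}'(\mathbb{Y}^{n+1})$ is defined by $\langle DS_\psi f,\Phi\rangle=\big\langle f,\overline{DS_\psi^{*}\overline{\Phi}}\big\rangle$ for $\Phi\in\mathcal{S}(\mathbb{Y}^{n+1})$; for $F\in\mathcal{S}'(\mathbb{Y}^{n+1})$, $DS_\psi^{*}F\in\mathcal{S}_0'(\mathbb{R}^n)$ is defined by $\langle DS_\psi^{*}F,\varphi\rangle=\big\langle F,\overline{DS_\psi\overline{\varphi}}\big\rangle$ for $\varphi\in\mathcal{S}_0(\mathbb{R}^n)$. *)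

(* Defs.v *)
From HB Require Import structures.
From mathcomp Require Import all_boot all_order all_algebra.
From mathcomp Require Import all_classical all_reals all_analysis.
From mathcomp Require Import measurable_realfun complex.

Set Implicit Arguments.
Unset Strict Implicit.
Unset Printing Implicit Defensive.
Import Order.TTheory GRing.Theory Num.Theory.
Import numFieldNormedType.Exports.
Local Open Scope classical_set_scope.
Local Open Scope complex_scope.
Local Open Scope ring_scope.

Lemma measurable_inv (R : realType) : measurable_fun setT (fun r : R => r^-1).
Proof.
rewrite -(setUv [set 0 : R]); apply/measurable_funU => //.
  exact: measurableC.
split.
  apply: (eq_measurable_fun (cst (0:R))) => [r|]; last exact: measurable_cst.
  by rewrite inE/= => ->; rewrite invr0.
apply: open_continuous_measurable_fun.
  rewrite openC; apply: accessible_closed_set1.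
  exact/hausdorff_accessible/Rhausdorff.
move=> r; rewrite inE/= => /eqP r0.
exact: inv_continuous.
Qed.

Lemma measurable_sqrt (R : realType) : measurable_fun setT (@Num.sqrt R).
Proof.
apply: continuous_measurable_fun; exact: sqrt_continuous.
Qed.

Section lebesgue_measure_n.
Context {R : realType}.
Local Notation X := (measurableTypeR R).

Definition tcons n (p : X * n.-tuple X) : n.+1.-tuple X :=
  [tuple of p.1 :: p.2].

Lemma measurable_tcons n : measurable_fun setT (@tcons n).
Proof. exact: measurable_cons. Qed.

Section step.
Variables (n : nat) (m : {sigma_finite_measure set (n.-tuple X) -> \bar R}).

Definition leb_step : set (n.+1.-tuple X) -> \bar R :=
  pushforward (@lebesgue_measure R \x m)%E (@tcons n).

HB.instance Definition _ := Measure.copy leb_step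
  (measure_function_pushforward__canonical__measure_function_Measure
     (@lebesgue_measure R \x m)%E (@measurable_tcons n)).

Let leb_step_sigma_finite : sigma_finite setT leb_step.
Proof.
have /sigma_finiteP[F [FT ndF Foo]] := sigma_finiteT (@lebesgue_measure R).
have /sigma_finiteP[G [GT ndG Goo]] := sigma_finiteT m.
pose H k : set (n.+1.-tuple X) :=
  [set t : n.+1.-tuple X | F k (thead t)] `&`
  [set t : n.+1.-tuple X | G k [tuple of behead t]].
exists H.
  apply/esym; rewrite predeqE => t; split => // _.
  have [i _ Fi] : (\bigcup_k F k) (thead t) by rewrite -FT.
  have [j _ Gj] : (\bigcup_k G k) [tuple of behead t] by rewrite -GT.
  exists (maxn i j) => //; split => /=.
    by move: Fi; exact/subsetPset/ndF/leq_maxl.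
  by move: Gj; exact/subsetPset/ndG/leq_maxr.
move=> k; have [mF Fk] := Foo k; have [mG Gk] := Goo k; split.
  apply: measurableI; rewrite -[X in measurable X]setTI.
    exact: (measurable_tnth ord0).
  exact: measurable_behead.
rewrite /leb_step /pushforward.
have -> : @tcons n @^-1` H k = F k `*` G k.
  rewrite predeqE => -[x t]; rewrite /H /tcons /= theadE.
  by have -> : [tuple of behead [tuple of x :: t]] = t by apply/val_inj.
by rewrite product_measure1E// lte_mul_pinfty// ge0_fin_numE.
Qed.

HB.instance Definition _ :=
  Measure_isSigmaFinite.Build _ _ _ leb_step leb_step_sigma_finite.

End step.

(* Lebesgue measure on R^n, as the n-fold product of the one on R. *)
Fixpoint leb n : {sigma_finite_measure set (n.-tuple X) -> \bar R} :=
  if n is k.+1 then leb_step (leb k) else dirac ([tuple] : 0.-tuple X).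

End lebesgue_measure_n.

Section euclidean.
Context {R : realType} {n : nat}.
Local Notation X := (measurableTypeR R).

Definition dot (x y : 'rV[R]_n) : R := \sum_i x 0 i * y 0 i.

Definition enorm (x : 'rV[R]_n) : R := Num.sqrt (dot x x).

Definition vec (t : n.-tuple X) : 'rV[R]_n := \row_i tnth t i.

Definition normalize (t : n.-tuple X) : n.-tuple X :=
  [tuple (tnth t i : R) / enorm (vec t) | i < n].

Definition punctured_ball : set (n.-tuple X) :=
  [set t | 0 < enorm (vec t) <= 1].

Lemma measurable_coord (i : 'I_n) :
  measurable_fun setT (fun t : n.-tuple X => tnth t i : R).
Proof. exact: measurable_tnth. Qed.

Lemma measurable_enorm_vec :
  measurable_fun setT (fun t : n.-tuple X => enorm (vec t)).
Proof.
apply: (measurableT_comp (@measurable_sqrt R)).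
rewrite /dot; under eq_fun do under eq_bigr do rewrite !mxE.
apply: measurable_sum => i.
by apply: measurable_funM; exact: measurable_coord.
Qed.

Lemma measurable_normalize : measurable_fun setT normalize.
Proof.
apply/measurable_fun_tnthP => i.
rewrite (_ : _ \o _ = fun t : n.-tuple X => (tnth t i : R) / enorm (vec t)).
  apply: measurable_funM; first exact: measurable_coord.
  apply: (@measurableT_comp _ _ _ _ _ _ (fun r : R => r^-1)).
    exact: measurable_inv.
  exact: measurable_enorm_vec.
by apply/funext => t /=; rewrite tnth_mktuple.
Qed.

Lemma measurable_punctured_ball : measurable punctured_ball.
Proof.
rewrite (_ : punctured_ball =
  (fun t : n.-tuple X => enorm (vec t)) @^-1` `]0, 1]%classic).
  by rewrite -[X in measurable X]setTI; exact: measurable_enorm_vec.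
by rewrite predeqE => t; rewrite /punctured_ball /= in_itv.
Qed.

(* Surface measure of the unit sphere, as a measure on R^n carried by the
   sphere: sigma(A) = n * lambda {x : 0 < |x| <= 1 and x / |x| in A}, the
   measure for which dx = r^(n-1) dr dsigma(u) in polar coordinates. *)
Definition sphere_measure : {measure set (n.-tuple X) -> \bar R} :=
  mscale (n%:R%:nng : {nonneg R})
    (measure_function_pushforward__canonical__measure_function_Measure
       (mrestr (leb n) measurable_punctured_ball) measurable_normalize).

End euclidean.

Section complex_valued.
Context {R : realType}.
Local Notation C := R[i].

Definition expi (t : R) : C := cos t +i* sin t.

Definition cintegral d (T : measurableType d) (mu : {measure set T -> \bar R})
    (D : set T) (f : T -> C) : C :=
  (\int[mu]_(x in D) complex.Re (f x)) +i* (\int[mu]_(x in D) complex.Im (f x)).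

Definition cintegrable d (T : measurableType d)
    (mu : {measure set T -> \bar R}) (D : set T) (f : T -> C) : Prop :=
  mu.-integrable D (fun x => (complex.Re (f x))%:E) /\
  mu.-integrable D (fun x => (complex.Im (f x))%:E).

Definition integralR (f : R -> C) : C := cintegral (@lebesgue_measure R) setT f.

Definition integralRn n (f : 'rV[R]_n -> C) : C :=
  cintegral (leb n) setT (fun t => f (vec t)).

Definition integralS n (f : 'rV[R]_n -> C) : C :=
  cintegral (@sphere_measure R n) setT (fun t => f (vec t)).

Definition partial n (i : 'I_n) (f : 'rV[R]_n -> C) : 'rV[R]_n -> C :=
  fun x => 'D_(delta_mx 0 i) (fun y => complex.Re (f y)) x
        +i* 'D_(delta_mx 0 i) (fun y => complex.Im (f y)) x.

(* C^infty: all iterated partial derivatives are (Frechet) differentiable. *)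
Definition smooth n (f : 'rV[R]_n -> C) : Prop :=
  forall (s : seq 'I_n) (x : 'rV[R]_n),
    differentiable (fun y => complex.Re (foldr (@partial n) f s y)) x /\
    differentiable (fun y => complex.Im (foldr (@partial n) f s y)) x.

Definition multi_partial n (beta : {ffun 'I_n -> nat}) (f : 'rV[R]_n -> C) :=
  foldr (fun i g => iter (beta i) (partial i) g) f (enum 'I_n).

Definition monomial n (alpha : {ffun 'I_n -> nat}) (x : 'rV[R]_n) : R :=
  \prod_i x 0 i ^+ alpha i.

Definition schwartz_seminorm n (alpha beta : {ffun 'I_n -> nat})
    (f : 'rV[R]_n -> C) : \bar R :=
  ereal_sup [set (`|monomial alpha x| * Normc.normc (multi_partial beta f x))%:E
            | x in [set: 'rV[R]_n]].

Definition schwartz n (f : 'rV[R]_n -> C) : Prop :=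
  smooth f /\ forall alpha beta, (schwartz_seminorm alpha beta f < +oo)%E.

Definition lizorkin n (f : 'rV[R]_n -> C) : Prop :=
  schwartz f /\
  forall m : {ffun 'I_n -> nat},
    integralRn (fun x => (monomial m x)%:C * f x) = 0.

(* A function on R, seen as a function on R^1. *)
Definition on_line (f : R -> C) : 'rV[R]_1 -> C := fun x => f (x 0 0).

Definition schwartz1 (f : R -> C) : Prop := schwartz (on_line f).

Definition S1 (f : R -> C) : Prop :=
  schwartz1 f /\ lizorkin (on_line (fun x => expi x * f x)).

(* The elements of S_0'(R^n) are represented by functions on the whole space of
   functions R^n -> C, of which only the values on S_0(R^n) matter.  Since the
   topology is given by countably many seminorms, a neighbourhood of phi0
   contains a ball for the seminorms with indices bounded by some N. *)
Definition lizorkin_dual n (f : ('rV[R]_n -> C) -> C) : Prop :=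
  (forall (c : C) phi chi, lizorkin phi -> lizorkin chi ->
     f (fun x => c * phi x + chi x) = c * f phi + f chi) /\
  (forall phi0, lizorkin phi0 -> forall eps : R, 0 < eps ->
     exists (N : nat) (delta : R), 0 < delta /\
     forall phi, lizorkin phi ->
       (forall alpha beta : {ffun 'I_n -> nat},
          (forall i, (alpha i <= N)%N) -> (forall i, (beta i <= N)%N) ->
          (schwartz_seminorm alpha beta (fun x => phi x - phi0 x)%R
             < delta%:E)%E) ->
       Normc.normc (f phi - f phi0) < eps).

End complex_valued.

Section directional_short_time.
Context {R : realType}.
Local Notation C := R[i].

Definition fourier (g : R -> C) (xi : R) : C :=
  integralR (fun x => g x * expi (- (x * xi))).

Definition C_integrand (n : nat) (psi eta : R -> C) (xi : R) : C :=
  conjc (fourier psi (xi - 1)) * fourier eta (xi - 1) / (`|xi| ^+ n)%:C.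

Definition C_const (n : nat) (psi eta : R -> C) : C :=
  (pi^-1)%:C * integralR (C_integrand n psi eta).

(* "Finite" is absolute convergence of the integral defining C_const. *)
Definition reconstruction_window (n : nat) (psi eta : R -> C) : Prop :=
  [/\ schwartz1 eta,
      cintegrable (@lebesgue_measure R) setT (C_integrand n psi eta)
    & C_const n psi eta != 0].

Definition atom n (psi : R -> C) (u : 'rV[R]_n) (b a : R) (x : 'rV[R]_n) : C :=
  (`|a| / (2 * pi) `^ (n%:R / 2))%:C *
  psi (a * (dot x u - b)) * expi (a * dot x u).

Definition DS n (psi : R -> C) (phi : 'rV[R]_n -> C)
    (u : 'rV[R]_n) (b a : R) : C :=
  integralRn (fun x => phi x * conjc (atom psi u b a x)).

(* Functions on Y^(n+1) = S^(n-1) x R x R^* are represented by functions on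
   R^n x R x R; only their values on Y^(n+1) enter the integral. *)
Definition DSadj n (psi : R -> C) (Phi : 'rV[R]_n -> R -> R -> C)
    (x : 'rV[R]_n) : C :=
  integralS (fun u =>
    cintegral (@lebesgue_measure R) [set a : R | a != 0] (fun a =>
      integralR (fun b =>
        Phi u b a * atom psi u b a x * (`|a| ^+ (n - 2))%:C))).

(* <DS_psi f, Phi> = <f, conj (DS_psi^* (conj Phi))> and
   <DS_psi^* F, phi> = <F, conj (DS_psi (conj phi))>.  The formulas make sense
   for all functions; on S(Y^(n+1)), resp. S_0(R^n), they are the action of the
   distributions DS_psi f and DS_psi^* F. *)
Definition DS_dual n (psi : R -> C) (f : ('rV[R]_n -> C) -> C)
    (Phi : 'rV[R]_n -> R -> R -> C) : C :=
  f (fun x => conjc (DSadj psi (fun u b a => conjc (Phi u b a)) x)).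

Definition DSadj_dual n (psi : R -> C)
    (F : ('rV[R]_n -> R -> R -> C) -> C) (phi : 'rV[R]_n -> C) : C :=
  F (fun u b a => conjc (DS psi (fun x => conjc (phi x)) u b a)).

End directional_short_time.

(* Main.v *)
Require Import Defs.
From mathcomp Require Import all_boot all_order all_algebra.
From mathcomp Require Import all_classical all_reals all_analysis.
From mathcomp Require Import complex.
From mathcomp Require Import measurable_realfun ring lra.
Import Order.TTheory GRing.Theory Num.Theory.
Import numFieldNormedType.Exports.
Local Open Scope classical_set_scope.
Local Open Scope complex_scope.
Local Open Scope ring_scope.
Set Implicit Arguments.
Unset Strict Implicit.
Unset Printing Implicit Defensive.

(* By linearity of [f], the claim reduces to the pointwise reconstruction formula
   [DS_psi^* (DS_eta chi) = C_{eta,psi} chi] for Schwartz functions [chi].  Writing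
   [chi^] for the Fourier transform, Fubini and Fourier inversion for [psi] turn
   the integral over [b] into
     (2 pi)^-(n+1) |a|^(n-1) int M(xi) H(xi a u) dxi,
   with [M(xi) = conj (eta^(xi - 1)) psi^(xi - 1)] and
   [H(w) = chi^(w) e^(i w.x)].  The substitution [a -> a / xi] then splits off
   [int M(xi) / |xi|^n dxi], which converges because [eta] is a reconstruction
   window.  Polar coordinates give [int_S int_R |a|^(n-1) H(a u) da du = 2 int H],
   and Fourier inversion on R^n identifies [int H] with [(2 pi)^n chi(x)]. *)

(** * Complex-valued integrals *)

(** Both operators act on distributions by transposition, so [f] receives conj (DS_psi^* (DS_eta
    (conj phi))). The windows thus exchange roles, and C_{eta,psi} = conj C_{psi,eta} is turned back
    by the outer conjugation. The factor 2 in polar coordinates reflects the two signs of a: a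
    vector w != 0 equals a u for (|w|, w/|w|) and for the opposite pair. What shapes the proof is
    absolute convergence. No joint integrability in (b, xi, a) is used: b and xi are exchanged for a
    fixed a != 0, where DS_eta chi is integrable in b, and a and xi are exchanged afterwards, for a
    fixed direction, where the weight |xi|^-n makes the double integral finite as soon as |a|^(n-1)
    H(a u) is integrable in a. That integrability, like every dominating function below, rests on
    the rapid decay of Fourier transforms of Schwartz functions. *)

Section complex_numbers.
Context {R : realType}.
Local Notation C := R[i].
Local Notation normc := (@Normc.normc R).
Implicit Types z w : C.

Lemma complexRe_M z w :
  complex.Re (z * w) = complex.Re z * complex.Re w - complex.Im z * complex.Im w.
Proof. by case: z w => [a b] [c d]. Qed.

Lemma complexIm_M z w :
  complex.Im (z * w) = complex.Re z * complex.Im w + complex.Im z * complex.Re w.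
Proof. by case: z w => [a b] [c d]. Qed.

Lemma complexRe_B z w : complex.Re (z - w) = complex.Re z - complex.Re w.
Proof. by case: z w => [a b] [c d]. Qed.

Lemma complexIm_B z w : complex.Im (z - w) = complex.Im z - complex.Im w.
Proof. by case: z w => [a b] [c d]. Qed.

Lemma complexRe_conj z : complex.Re (conjc z) = complex.Re z.
Proof. by case: z. Qed.

Lemma complexIm_conj z : complex.Im (conjc z) = - complex.Im z.
Proof. by case: z. Qed.

Lemma conjcM z w : conjc (z * w) = conjc z * conjc w.
Proof. exact: rmorphM. Qed.

Lemma complex_ext z w :
  complex.Re z = complex.Re w -> complex.Im z = complex.Im w -> z = w.
Proof. by case: z w => [a b] [c d] /= -> ->. Qed.

Lemma normc_ge0 z : 0 <= normc z.
Proof. by case: z => a b /=; exact: sqrtr_ge0. Qed.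

Lemma normRe_le z : `|complex.Re z| <= normc z.
Proof.
case: z => a b /=; rewrite -sqrtr_sqr ler_sqrt ?lerDl ?sqr_ge0//.
by rewrite addr_ge0 ?sqr_ge0.
Qed.

Lemma normIm_le z : `|complex.Im z| <= normc z.
Proof.
case: z => a b /=; rewrite -sqrtr_sqr ler_sqrt ?lerDr ?sqr_ge0//.
by rewrite addr_ge0 ?sqr_ge0.
Qed.

Lemma normc_leD z : normc z <= `|complex.Re z| + `|complex.Im z|.
Proof.
case: z => a b /=; rewrite -[leRHS]ger0_norm ?addr_ge0// -sqrtr_sqr.
rewrite ler_sqrt ?sqr_ge0// sqrrD !real_normK ?num_real// -addrA lerD2l lerDr.
by rewrite mulrn_wge0// mulr_ge0.
Qed.

Lemma normc_conj z : normc (conjc z) = normc z.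
Proof. by case: z => a b /=; rewrite sqrrN. Qed.

Lemma normc_real (x : R) : normc x%:C = `|x|.
Proof. by rewrite /= expr0n addr0 sqrtr_sqr. Qed.

Lemma normc_expi (t : R) : normc (expi t) = 1.
Proof. by rewrite /= cos2Dsin2 sqrtr1. Qed.

Lemma normcM_expi z (t : R) : normc (z * expi t) = normc z.
Proof. by rewrite Normc.normcM normc_expi mulr1. Qed.

Lemma expiD (s t : R) : expi (s + t) = expi s * expi t.
Proof. by apply: complex_ext; rewrite /= ?cosD ?sinD ?[sin s * cos t]mulrC addrC. Qed.

Lemma expi0 : expi (0 : R) = 1.
Proof. by rewrite /expi cos0 sin0. Qed.

Lemma expi_conj (t : R) : conjc (expi t) = expi (- t).
Proof. by rewrite /expi /= cosN sinN. Qed.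

End complex_numbers.

Lemma complexReZ {R : realType} (a : R) (z : R[i]) :
  complex.Re (a%:C * z) = a * complex.Re z.
Proof. by rewrite complexRe_M /= mul0r subr0. Qed.

Lemma complexImZ {R : realType} (a : R) (z : R[i]) :
  complex.Im (a%:C * z) = a * complex.Im z.
Proof. by rewrite complexIm_M /= mul0r addr0. Qed.

Section complex_measurability.
Context {R : realType} d (T : measurableType d).
Local Notation C := R[i].
Local Notation normc := (@Normc.normc R).
Implicit Types f g : T -> C.

Definition cmeasurable f := measurable_fun setT (fun x => complex.Re (f x)) /\
  measurable_fun setT (fun x => complex.Im (f x)).

Lemma cmeasurableM f g :
  cmeasurable f -> cmeasurable g -> cmeasurable (fun x => f x * g x).
Proof.
move=> [fr fi] [gr gi]; split.
  under eq_fun do rewrite complexRe_M.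
  by apply: measurable_funB; apply: measurable_funM.
under eq_fun do rewrite complexIm_M.
by apply: measurable_funD; apply: measurable_funM.
Qed.

Lemma cmeasurable_real (r : T -> R) :
  measurable_fun setT r -> cmeasurable (fun x => (r x)%:C).
Proof. by move=> mr; split=> //=; exact: measurable_cst. Qed.

Lemma cmeasurable_cst (c : C) : cmeasurable (fun=> c).
Proof. by split; exact: measurable_cst. Qed.

Lemma cmeasurable_conj f : cmeasurable f -> cmeasurable (fun x => conjc (f x)).
Proof.
move=> [fr fi]; split.
  by under eq_fun do rewrite complexRe_conj.
under eq_fun do rewrite complexIm_conj.
exact: measurableT_comp.
Qed.

Lemma cmeasurable_expi (r : T -> R) :
  measurable_fun setT r -> cmeasurable (fun x => expi (r x)).
Proof.
move=> mr; split => /=.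
  exact: (measurableT_comp (continuous_measurable_fun (@continuous_cos R))).
exact: (measurableT_comp (continuous_measurable_fun (@continuous_sin R))).
Qed.

Lemma measurable_normc f : cmeasurable f ->
  measurable_fun setT (fun x => normc (f x)).
Proof.
move=> [fr fi].
rewrite (_ : (fun _ => _) = fun x =>
  Num.sqrt (complex.Re (f x) ^+ 2 + complex.Im (f x) ^+ 2)); last first.
  by apply/funext => x; case: (f x).
apply: (measurableT_comp (@measurable_sqrt R)).
by apply: measurable_funD; apply: measurable_funX.
Qed.

End complex_measurability.

Lemma cmeasurable_comp {R : realType} d d' (T : measurableType d)
    (T' : measurableType d') (f : T' -> R[i]) (g : T -> T') :
  measurable_fun setT g -> cmeasurable f -> cmeasurable (fun x => f (g x)).
Proof.
move=> mg [fr fi].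
by split; [exact: (measurableT_comp fr)|exact: (measurableT_comp fi)].
Qed.

Section complex_integral.
Context {R : realType} d (T : measurableType d).
Variable mu : {measure set T -> \bar R}.
Local Notation C := R[i].
Local Notation normc := (@Normc.normc R).
Implicit Types f g : T -> C.

Lemma cintegrable_measurable f : cintegrable mu setT f -> cmeasurable f.
Proof.
by move=> [/measurable_int/measurable_EFinP ? /measurable_int/measurable_EFinP ?].
Qed.

Lemma cintegrable_le f (g : T -> R) : cmeasurable f ->
  mu.-integrable setT (EFin \o g) -> (forall x, normc (f x) <= g x) ->
  cintegrable mu setT f.
Proof.
move=> [fr fi] ig fg; split; apply: le_integrable ig => //=;
  try (by apply/measurable_EFinP); move=> x _; rewrite lee_fin.
  by rewrite (le_trans (normRe_le _))// (le_trans (fg _))// ler_norm.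
by rewrite (le_trans (normIm_le _))// (le_trans (fg _))// ler_norm.
Qed.

Lemma cintegrable_normc f : cintegrable mu setT f ->
  mu.-integrable setT (fun x => (normc (f x))%:E).
Proof.
move=> intf; have mf := cintegrable_measurable intf.
have [ir ii] := intf.
apply: (@le_integrable _ _ _ _ _ _ _ (fun x =>
   `|(complex.Re (f x))%:E| + `|(complex.Im (f x))%:E|)%E) => //.
- exact/measurable_EFinP/measurable_normc.
- move=> x _; rewrite /= lee_fin ger0_norm ?normc_ge0//.
  by rewrite [leRHS]ger0_norm ?addr_ge0// normc_leD.
- by apply: integrableD => //; apply: integrable_abse.
Qed.

Lemma cintegrable_normcP f : cmeasurable f ->
  (\int[mu]_x (normc (f x))%:E < +oo)%E -> cintegrable mu setT f.
Proof.
move=> mf foo; apply: (@cintegrable_le _ (fun x => normc (f x))) => //.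
apply/integrableP; split.
  exact/measurable_EFinP/measurable_normc.
by under eq_integral do rewrite /= ger0_norm ?normc_ge0//.
Qed.

Lemma cintegrableM_bounded f g K : cintegrable mu setT f -> cmeasurable g ->
  (forall x, normc (g x) <= K) -> cintegrable mu setT (fun x => g x * f x).
Proof.
move=> intf mg gK; have mf := cintegrable_measurable intf.
apply: (@cintegrable_le _ (fun x => K * normc (f x))).
- exact: cmeasurableM.
- have := integrableZl measurableT K (cintegrable_normc intf).
  by apply: eq_integrable => // x _ /=; rewrite EFinM.
- by move=> x; rewrite Normc.normcM ler_wpM2r ?normc_ge0.
Qed.

Lemma cintegrableZ f c : cintegrable mu setT f ->
  cintegrable mu setT (fun x => c * f x).
Proof.
move=> intf; apply: (cintegrableM_bounded (K := normc c)) => //.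
Qed.

Lemma cintegrableB f g : cintegrable mu setT f -> cintegrable mu setT g ->
  cintegrable mu setT (fun x => f x - g x).
Proof.
move=> [fr fi] [gr gi]; split.
  by under eq_fun do rewrite complexRe_B EFinB; exact: integrableB.
by under eq_fun do rewrite complexIm_B EFinB; exact: integrableB.
Qed.

Lemma cintegrable_conj f : cintegrable mu setT f ->
  cintegrable mu setT (fun x => conjc (f x)).
Proof.
move=> [fr fi]; split; first by under eq_fun do rewrite complexRe_conj.
by under eq_fun do rewrite complexIm_conj EFinN; exact: integrableN.
Qed.

Lemma eq_cintegral D f g : {in D, f =1 g} ->
  cintegral mu D f = cintegral mu D g.
Proof.
by move=> fg; congr (_ +i* _); apply: eq_Rintegral => x /fg ->.
Qed.

Lemma cintegralZ f c : cintegrable mu setT f ->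
  cintegral mu setT (fun x => c * f x) = c * cintegral mu setT f.
Proof.
move=> [fr fi]; apply: complex_ext; rewrite ?complexRe_M ?complexIm_M /=.
  under eq_Rintegral do rewrite complexRe_M.
  rewrite RintegralB ?RintegralZl//.
    by have := integrableZl measurableT (complex.Re c) fr;
      apply: eq_integrable => // x _ /=; rewrite EFinM.
  by have := integrableZl measurableT (complex.Im c) fi;
    apply: eq_integrable => // x _ /=; rewrite EFinM.
under eq_Rintegral do rewrite complexIm_M.
rewrite RintegralD ?RintegralZl//.
  by have := integrableZl measurableT (complex.Re c) fi;
    apply: eq_integrable => // x _ /=; rewrite EFinM.
by have := integrableZl measurableT (complex.Im c) fr;
  apply: eq_integrable => // x _ /=; rewrite EFinM.
Qed.

Lemma cintegralZr f c : cintegrable mu setT f ->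
  cintegral mu setT (fun x => f x * c) = cintegral mu setT f * c.
Proof.
by move=> ?; rewrite mulrC -cintegralZ//; apply: eq_cintegral => x _; rewrite mulrC.
Qed.

Lemma cintegralB f g : cintegrable mu setT f -> cintegrable mu setT g ->
  cintegral mu setT (fun x => f x - g x) =
  cintegral mu setT f - cintegral mu setT g.
Proof.
move=> [fr fi] [gr gi]; apply: complex_ext; rewrite ?complexRe_B ?complexIm_B /=.
  by rewrite -RintegralB//; apply: eq_Rintegral => x _; rewrite complexRe_B.
by rewrite -RintegralB//; apply: eq_Rintegral => x _; rewrite complexIm_B.
Qed.

Lemma cintegral_conj f : cintegrable mu setT f ->
  cintegral mu setT (fun x => conjc (f x)) = conjc (cintegral mu setT f).
Proof.
move=> [fr fi]; apply: complex_ext; rewrite ?complexRe_conj ?complexIm_conj /=.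
  by apply: eq_Rintegral => x _; rewrite complexRe_conj.
under eq_Rintegral do rewrite complexIm_conj -mulN1r.
by rewrite RintegralZl// mulN1r.
Qed.

(** The factor 2 comes from estimating real and imaginary parts separately; it is harmless, since
    only boundedness is drawn from this estimate. *)
Lemma normc_cintegral_le f : cintegrable mu setT f ->
  normc (cintegral mu setT f) <= 2 * \int[mu]_x normc (f x).
Proof.
move=> intf; have [fr fi] := intf.
have inf := cintegrable_normc intf.
apply: (le_trans (normc_leD _)); rewrite mulrDl mul1r lerD//=.
  apply: (le_trans (le_normr_Rintegral measurableT fr)).
  apply: le_Rintegral => //.
    exact: (integrable_abse fr).
  by move=> x _; exact: normRe_le.
apply: (le_trans (le_normr_Rintegral measurableT fi)).
apply: le_Rintegral => //.
  exact: (integrable_abse fi).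
by move=> x _; exact: normIm_le.
Qed.

End complex_integral.

Lemma ae_eq_integrable {R : realType} d (T : measurableType d)
    (mu : {measure set T -> \bar R}) (f g : T -> \bar R) :
  measurable_fun setT f -> ae_eq mu setT f g -> mu.-integrable setT g ->
  mu.-integrable setT f.
Proof.
move=> mf fg /integrableP[mg goo]; apply/integrableP; split => //.
rewrite (ae_eq_integral (fun x => `|g x|%E))//.
- exact: measurableT_comp.
- exact: measurableT_comp.
- by apply: filterS fg => x /= fgx _; rewrite fgx.
Qed.

Lemma cintegral_mkcond {R : realType} d (T : measurableType d)
    (mu : {measure set T -> \bar R}) (D : set T) (f : T -> R[i]) :
  cintegral mu D f = cintegral mu setT (fun x => if x \in D then f x else 0).
Proof.
apply: complex_ext; rewrite /cintegral /= Rintegral_mkcond;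
  by apply: eq_Rintegral => x _; rewrite patchE; case: ifP.
Qed.

(** * Fubini's theorem for complex-valued functions *)

Section complex_fubini.
Context {R : realType} d1 d2 (T1 : measurableType d1) (T2 : measurableType d2).
Variables (m1 : {sigma_finite_measure set T1 -> \bar R}).
Variables (m2 : {sigma_finite_measure set T2 -> \bar R}).
Local Notation normc := (@Normc.normc R).
Implicit Type f : T1 * T2 -> R[i].

(** Almost every section is integrable, so that [fine] alters the inner integral only on a null
    set. *)
Let fine_F (f : T1 * T2 -> R) : (m1 \x m2)%E.-integrable setT (EFin \o f) ->
  m1.-integrable setT (fun x => (\int[m2]_y f (x, y))%:E) /\
  \int[m1]_x \int[m2]_y f (x, y) = \int[(m1 \x m2)%E]_z f z.
Proof.
move=> intf.
have mF : measurable_fun setT (fun x => (\int[m2]_y f (x, y))%:E).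
  apply/measurable_EFinP/(measurableT_comp (fine_measurable measurableT)).
  exact: (measurable_fubini_F intf).
have aeF : ae_eq m1 setT (fun x => (\int[m2]_y f (x, y))%:E)
    (fun x => \int[m2]_y (f (x, y))%:E)%E.
  have := ae_integrable1 intf; apply: filterS => x intx _ /=.
  by rewrite fineK//; exact: integrable_fin_num.
split.
  exact: (ae_eq_integrable mF aeF (integrable_fubini_F intf)).
rewrite /Rintegral -integral12_prod_meas1//; congr fine.
apply: ae_eq_integral => //.
exact: (measurable_fubini_F intf).
Qed.

Let fine_G (f : T1 * T2 -> R) : (m1 \x m2)%E.-integrable setT (EFin \o f) ->
  \int[m2]_y \int[m1]_x f (x, y) = \int[(m1 \x m2)%E]_z f z.
Proof.
move=> intf.
have mG : measurable_fun setT (fun y => (\int[m1]_x f (x, y))%:E).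
  apply/measurable_EFinP/(measurableT_comp (fine_measurable measurableT)).
  exact: (measurable_fubini_G intf).
rewrite /Rintegral -integral21_prod_meas1//; congr fine.
apply: ae_eq_integral => //; first exact: (measurable_fubini_G intf).
have := ae_integrable2 intf; apply: filterS => y inty _ /=.
by rewrite fineK//; exact: integrable_fin_num.
Qed.

Lemma cintegral12 f : cintegrable (m1 \x m2)%E setT f ->
  cintegral m1 setT (fun x => cintegral m2 setT (fun y => f (x, y))) =
  cintegral (m1 \x m2)%E setT f.
Proof.
by move=> [/fine_F[_ fr] /fine_F[_ fi]]; congr (_ +i* _).
Qed.

Lemma cintegral21 f : cintegrable (m1 \x m2)%E setT f ->
  cintegral m2 setT (fun y => cintegral m1 setT (fun x => f (x, y))) =
  cintegral (m1 \x m2)%E setT f.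
Proof.
by move=> [/fine_G fr /fine_G fi]; congr (_ +i* _).
Qed.

Lemma cintegrable_cintegral f : cintegrable (m1 \x m2)%E setT f ->
  cintegrable m1 setT (fun x => cintegral m2 setT (fun y => f (x, y))).
Proof. by move=> [/fine_F[fr _] /fine_F[fi _]]. Qed.

Lemma cintegrable_prod21 f : cmeasurable f ->
  (\int[m2]_y \int[m1]_x (normc (f (x, y)))%:E < +oo)%E ->
  cintegrable (m1 \x m2)%E setT f.
Proof.
move=> mf foo; apply: cintegrable_normcP => //; rewrite fubini_tonelli2//.
  exact/measurable_EFinP/measurable_normc.
by move=> x; rewrite lee_fin normc_ge0.
Qed.

Lemma integrable_prodM (g : T1 -> R) (h : T2 -> R) :
  m1.-integrable setT (EFin \o g) -> m2.-integrable setT (EFin \o h) ->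
  (m1 \x m2)%E.-integrable setT (fun z => (g z.1 * h z.2)%:E).
Proof.
move=> ig ih.
have mg : measurable_fun setT g by have /measurable_EFinP := measurable_int _ ig.
have mh : measurable_fun setT h by have /measurable_EFinP := measurable_int _ ih.
apply/integrable12ltyP => /=.
  by apply/measurable_EFinP; apply: measurable_funM; apply: measurableT_comp.
under eq_integral => x _.
  under eq_integral do rewrite normrM EFinM.
  rewrite ge0_integralZl//; last exact/measurable_EFinP/measurableT_comp.
  over.
rewrite /= ge0_integralZr//.
- apply: lte_mul_pinfty; first exact: integral_ge0.
    by rewrite ge0_fin_numE ?integral_ge0//; case/integrableP : ig.
  by case/integrableP : ih.
- exact/measurable_EFinP/measurableT_comp.
- exact: integral_ge0.
Qed.

Lemma cintegrable_prodM_le f (g : T1 -> R) (h : T2 -> R) : cmeasurable f ->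
  m1.-integrable setT (EFin \o g) -> m2.-integrable setT (EFin \o h) ->
  (forall x y, normc (f (x, y)) <= g x * h y) ->
  cintegrable (m1 \x m2)%E setT f.
Proof.
move=> mf ig ih fgh; apply: (cintegrable_le mf (integrable_prodM ig ih)).
by case.
Qed.

End complex_fubini.

(** * Lebesgue measure on R^n *)

Section change_of_variables.
Context {R : realType} d d' (T : measurableType d) (T' : measurableType d').
Variables (mu : {measure set T -> \bar R}) (nu : {measure set T' -> \bar R}).
Variables (phi : T -> T') (c : R).
Hypothesis mphi : measurable_fun setT phi.
Hypothesis c_gt0 : 0 < c.
(** Nonnegative functions suffice as input, where no integrability is at stake; positive and
    negative parts, then real and imaginary parts, give the rest. *)
Hypothesis phiE : forall f : T' -> \bar R, measurable_fun setT f ->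
  (forall x, 0 <= f x)%E -> (\int[mu]_x f (phi x) = c%:E * \int[nu]_x f x)%E.

Lemma integrable_change (f : T' -> R) : measurable_fun setT f ->
  mu.-integrable setT (fun x => (f (phi x))%:E) <->
  nu.-integrable setT (fun x => (f x)%:E).
Proof.
move=> mf.
have E := phiE (f := fun x => `|(f x)%:E|%E); split=> /integrableP[_ foo];
  apply/integrableP; split; try by apply/measurable_EFinP => //;
  exact: measurableT_comp.
  move: foo; rewrite /= in E *; rewrite E//; last first.
    by apply/measurable_EFinP; apply: measurableT_comp.
  rewrite muleC -lte_pdivlMr// => /lt_le_trans; apply.
  by rewrite mulyr gtr0_sg ?invr_gt0// mul1e.
rewrite /= in E *; rewrite E//; last first.
  by apply/measurable_EFinP; apply: measurableT_comp.
by rewrite lte_mul_pinfty// lee_fin ltW.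
Qed.

Lemma Rintegral_change (f : T' -> R) : nu.-integrable setT (EFin \o f) ->
  \int[mu]_x f (phi x) = c * \int[nu]_x f x.
Proof.
move=> intf; have mf := measurable_int _ intf.
rewrite /Rintegral -[X in X * _]/(fine c%:E) -fineM//; last first.
  exact: integrable_fin_num.
congr fine; rewrite integralE [in RHS]integralE muleBr//; last first.
  apply: fin_num_adde_defr.
  by apply: integrable_fin_num => //; exact: integrable_funepos.
congr (_ - _)%E.
  rewrite -phiE//; last exact: measurable_funepos.
  by rewrite -[in LHS]/((EFin \o f) \o phi) funepos_comp.
rewrite -phiE//; last exact: measurable_funeneg.
by rewrite -[in LHS]/((EFin \o f) \o phi) funeneg_comp.
Qed.

Lemma cintegrable_change (f : T' -> R[i]) : cmeasurable f ->
  cintegrable mu setT (fun x => f (phi x)) <-> cintegrable nu setT f.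
Proof.
move=> [mr mi]; have Er := integrable_change mr; have Ei := integrable_change mi.
by split=> -[fr fi]; split; [exact/Er|exact/Ei|exact/Er|exact/Ei].
Qed.

Lemma cintegral_change (f : T' -> R[i]) : cintegrable nu setT f ->
  cintegral mu setT (fun x => f (phi x)) = c%:C * cintegral nu setT f.
Proof.
move=> [fr fi]; apply: complex_ext; rewrite ?complexRe_M ?complexIm_M /=.
  by rewrite mul0r subr0 (Rintegral_change (f := fun x => complex.Re (f x))).
by rewrite mul0r addr0 (Rintegral_change (f := fun x => complex.Im (f x))).
Qed.

End change_of_variables.

Section affine1.
Context {R : realType}.
Local Notation lambda := (@lebesgue_measure R).

Lemma measurable_affine (s v : R) :
  measurable_fun setT (fun x : measurableTypeR R => s * x + v : measurableTypeR R).
Proof. by apply: measurable_funD => //; apply: measurable_funM. Qed.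

(** Lebesgue measure is determined by its values on the intervals ]a, b], and [|s|] times the image
    measure agrees with it there. For s < 0 the preimage is reversed and becomes closed on the left
    and open on the right. *)
Lemma ge0_integral_affine (s v : R) (f : R -> \bar R) : s != 0 ->
  measurable_fun setT f -> (forall x, 0 <= f x)%E ->
  (\int[lambda]_x f (s * x + v)%R = (`|s|^-1)%:E * \int[lambda]_x f x)%E.
Proof.
move=> s0 mf f0.
pose k : {nonneg R} := NngNum (normr_ge0 s).
pose m : {measure set (measurableTypeR R) -> \bar R} :=
  mscale k (measure_function_pushforward__canonical__measure_function_Measure
     lambda (measurable_affine s v)).
have mE A : measurable A -> lambda A = m A.
  apply: lebesgue_measure_unique => _ [[a b] _ <-].
  rewrite /m/= /mscale/= /pushforward [in LHS]lebesgue_measure_itv/=.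
  have [sgt|slt] := ltrP 0 s.
    rewrite (_ : _ @^-1` _ = [set` `](a - v) / s, (b - v) / s]]); last first.
      apply/seteqP; split => x /=; rewrite !in_itv/= ltr_pdivrMr// ler_pdivlMr//;
        by rewrite ltrBlDr lerBrDr mulrC.
    rewrite lebesgue_measure_itv/= !lte_fin ltr_pM2r ?invr_gt0// ltrD2r gtr0_norm//.
    case: ifPn => _; last by rewrite mule0.
    by rewrite -!EFinB -EFinM; congr (_%:E); field.
  have sgt : s < 0 by rewrite lt_neqAle s0.
  rewrite (_ : _ @^-1` _ = [set` `[(b - v) / s, (a - v) / s[]); last first.
    apply/seteqP; split => x /=; rewrite !in_itv/= ltr_ndivlMr// ler_ndivrMr//;
      by rewrite ltrBlDr lerBrDr mulrC andbC.
  rewrite lebesgue_measure_itv/= !lte_fin ltr_nM2r ?invr_lt0// ltrD2r ltr0_norm//.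
  case: ifPn => _; last by rewrite mule0.
  by rewrite -!EFinB -EFinM; congr (_%:E); field.
rewrite [in RHS](eq_measure_integral m); last by move=> A mA _; exact: mE.
rewrite ge0_integral_mscale//.
have := ge0_integral_pushforward (measurable_affine s v) lambda measurableT mf
  (fun x _ => f0 x).
rewrite preimage_setT => E.
transitivity (`|s|^-1%:E * (`|s|%:E * \int[lambda]_x f (s * x + v)%R))%E.
  by rewrite muleA -EFinM mulVf ?normr_eq0// mul1e.
by congr (_ * (_ * _))%E; exact/esym.
Qed.

Lemma cintegrable_affine (s v : R) (f : R -> R[i]) : s != 0 ->
  cintegrable lambda setT f -> cintegrable lambda setT (fun x => f (s * x + v)).
Proof.
move=> s0 intf; have mf := cintegrable_measurable intf.
by have [_] := cintegrable_change (measurable_affine s v)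
  (ltac:(by rewrite invr_gt0 normr_gt0) : 0 < `|s|^-1)
  (fun g mg g0 => ge0_integral_affine v s0 mg g0) mf; apply.
Qed.

Lemma cintegral_affine (s v : R) (f : R -> R[i]) : s != 0 ->
  cintegrable lambda setT f ->
  cintegral lambda setT (fun x => f (s * x + v)) =
  (`|s|^-1)%:C * cintegral lambda setT f.
Proof.
move=> s0 intf.
exact: (@cintegral_change R _ _ (measurableTypeR R) (measurableTypeR R)
  lambda lambda (fun x => s * x + v) _
  (fun g mg g0 => ge0_integral_affine v s0 mg g0) f intf).
Qed.

End affine1.

Section lebesgue_n.
Context {R : realType}.
Local Notation lambda := (@lebesgue_measure R).
Local Notation X := (measurableTypeR R).

Lemma ge0_integral_leb_cons n (f : n.+1.-tuple X -> \bar R) :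
  measurable_fun setT f -> (forall t, 0 <= f t)%E ->
  (\int[(lambda \x leb n)%E]_p f (tcons p) = \int[leb n.+1]_t f t)%E.
Proof.
move=> mf f0; rewrite /= /leb_step ge0_integral_pushforward//.
exact: measurable_tcons.
Qed.

Definition taffine n (s : R) (v : 'I_n -> R) (t : n.-tuple X) : n.-tuple X :=
  [tuple s * tnth t i + v i | i < n].

Lemma measurable_taffine n (s : R) (v : 'I_n -> R) : measurable_fun setT (taffine s v).
Proof.
apply/measurable_fun_tnthP => i.
rewrite (_ : _ \o _ = fun t : n.-tuple X => s * tnth t i + v i); last first.
  by apply/funext => t /=; rewrite tnth_mktuple.
by apply: (measurableT_comp (measurable_affine s (v i))); exact: measurable_tnth.
Qed.

Lemma taffine_tcons n (s : R) (v : 'I_n.+1 -> R) (x : X) (t : n.-tuple X) :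
  taffine s v (tcons (x, t)) =
  tcons (s * x + v ord0 : X, taffine s (v \o lift ord0) t).
Proof.
apply: eq_from_tnth => i; rewrite tnth_mktuple.
case: (unliftP ord0 i) => [j ->|->]; last by rewrite !tnth0.
by rewrite /tcons/= !tnthS tnth_mktuple.
Qed.

(** Induction on the dimension: Tonelli splits off the first coordinate, and each coordinate
    contributes one factor [|s|^-1]. The shift is generalised because its tail is what the induction
    hypothesis meets. *)
Lemma ge0_integral_taffine n (s : R) (v : 'I_n -> R) (f : n.-tuple X -> \bar R) :
  s != 0 -> measurable_fun setT f -> (forall x, 0 <= f x)%E ->
  (\int[leb n]_t f (taffine s v t) = (`|s|^-1 ^+ n)%:E * \int[leb n]_t f t)%E.
Proof.
move=> s0; elim: n => [|n IHn] in v f *; move=> mf f0.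
  rewrite expr0 mul1e; apply: eq_integral => t _; congr f.
  by apply: eq_from_tnth; case.
have mf' : measurable_fun setT (f \o @tcons R n).
  by apply: measurableT_comp => //; exact: measurable_tcons.
have mfa : measurable_fun setT (f \o taffine s v).
  by apply: measurableT_comp => //; exact: measurable_taffine.
have mF : measurable_fun setT (fun x : X => \int[leb n]_t f (tcons (x, t)))%E.
  apply: (measurable_fun_fubini_tonelli_F (f \o @tcons R n)) => //.
  by move=> ?; exact: f0.
rewrite -!ge0_integral_leb_cons//.
rewrite fubini_tonelli1//; last first.
  by apply: (measurableT_comp mfa); exact: measurable_tcons.
rewrite [in RHS]fubini_tonelli1// /fubini_F.
under eq_integral => x _.
  under eq_integral => t _ do rewrite taffine_tcons.
  rewrite (IHn _ (fun t => f (tcons (s * x + v ord0, t))))//; last first.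
    exact: (measurableT_comp mf').
  over.
have mFs := measurableT_comp mF (measurable_affine s (v ord0)).
have F0 (x : X) : (0 <= \int[leb n]_t f (tcons (x, t)))%E by exact: integral_ge0.
rewrite (@ge0_integralZl _ _ _ lambda _ measurableT _ mFs); last 2 first.
- by move=> x _; exact: F0.
- by rewrite lee_fin exprn_ge0// invr_ge0.
rewrite (@ge0_integral_affine _ s (v ord0) (fun x => \int[leb n]_t f (tcons (x, t)))%E)//.
- by rewrite muleA -EFinM -exprSr.
Qed.

Lemma cintegrable_taffine n (s : R) (v : 'I_n -> R) (f : n.-tuple X -> R[i]) :
  s != 0 -> cintegrable (leb n) setT f ->
  cintegrable (leb n) setT (fun t => f (taffine s v t)).
Proof.
move=> s0 intf; have mf := cintegrable_measurable intf.
by have [_] := cintegrable_change (measurable_taffine s v)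
  (ltac:(by rewrite exprn_gt0// invr_gt0 normr_gt0) : 0 < `|s|^-1 ^+ n)
  (fun g mg g0 => ge0_integral_taffine v s0 mg g0) mf; apply.
Qed.

Lemma cintegral_taffine n (s : R) (v : 'I_n -> R) (f : n.-tuple X -> R[i]) :
  s != 0 -> cintegrable (leb n) setT f ->
  cintegral (leb n) setT (fun t => f (taffine s v t)) =
  (`|s|^-1 ^+ n)%:C * cintegral (leb n) setT f.
Proof.
move=> s0 intf.
exact: (cintegral_change (phi := taffine s v)
  (fun g mg g0 => ge0_integral_taffine v s0 mg g0) intf).
Qed.

Lemma cintegrable_leb_cons n (f : n.+1.-tuple X -> R[i]) : cmeasurable f ->
  cintegrable (lambda \x leb n)%E setT (fun p => f (tcons p)) <->
  cintegrable (leb n.+1) setT f.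
Proof.
apply: (@cintegrable_change _ _ _ _ _ _ _ _ 1) => //; first exact: measurable_tcons.
by move=> g mg g0; rewrite mul1e ge0_integral_leb_cons.
Qed.

Lemma cintegral_leb_cons n (f : n.+1.-tuple X -> R[i]) :
  cintegrable (leb n.+1) setT f ->
  cintegral (lambda \x leb n)%E setT (fun p => f (tcons p)) =
  cintegral (leb n.+1) setT f.
Proof.
move=> intf; rewrite (@cintegral_change _ _ _ _ _ _ (leb n.+1) _ 1)// ?mul1r//.
by move=> g mg g0; rewrite mul1e ge0_integral_leb_cons.
Qed.

Lemma cmeasurable_prod d (T : measurableType d) (I : Type) (r : seq I)
    (F : I -> T -> R[i]) :
  (forall i, cmeasurable (F i)) -> cmeasurable (fun t => \prod_(i <- r) F i t).
Proof.
move=> mF; elim: r => [|i r IHr].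
  by under eq_fun do rewrite big_nil; exact: cmeasurable_cst.
by under eq_fun do rewrite big_cons; exact: cmeasurableM.
Qed.

(** Integrability and value are proved together, since Fubini needs the first to give the second. In
    dimension 0 the measure is a Dirac mass and both products are empty. *)
Lemma leb_prod n (g : 'I_n -> R -> R[i]) :
  (forall i, cintegrable lambda setT (g i)) ->
  cintegrable (leb n) setT (fun t => \prod_i g i (tnth t i)) /\
  cintegral (leb n) setT (fun t => \prod_i g i (tnth t i)) =
  \prod_i cintegral lambda setT (g i).
Proof.
elim: n => [|n IHn] in g *; move=> ig.
  under eq_fun do rewrite big_ord0.
  rewrite big_ord0; split.
    split; apply/integrableP; split => //=; rewrite integral_dirac//=;
      by rewrite diracE in_setT mul1e ltry.
  rewrite /cintegral /Rintegral /= !integral_dirac//=.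
  by rewrite indicE in_setT mulr1 mulr0.
have [ipr Epr] := IHn (g \o lift ord0) (fun i => ig _).
have mg i : cmeasurable (g i : X -> R[i]) by exact: cintegrable_measurable.
have mP : cmeasurable (fun t : n.+1.-tuple X => \prod_i g i (tnth t i)).
  apply: cmeasurable_prod => i; apply: cmeasurable_comp => //.
  exact: measurable_tnth.
have E p : \prod_i g i (tnth (tcons p) i) =
    g ord0 p.1 * \prod_i (g \o lift ord0) i (tnth p.2 i).
  rewrite big_ord_recl tnth0; congr (_ * _).
  by apply: eq_bigr => i _; rewrite tnthS; case: p => a [].
have ip : cintegrable (lambda \x leb n)%E setT
    (fun p => g ord0 p.1 * \prod_i (g \o lift ord0) i (tnth p.2 i)).
  apply: (cintegrable_prodM_le _ (cintegrable_normc (ig ord0)) (cintegrable_normc ipr)).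
    apply: cmeasurableM; first exact: (cmeasurable_comp _ (mg ord0)).
    exact: (cmeasurable_comp _ (cintegrable_measurable ipr)).
  by move=> x t /=; rewrite Normc.normcM.
have iP : cintegrable (leb n.+1) setT (fun t => \prod_i g i (tnth t i)).
  by apply/cintegrable_leb_cons => //; under eq_fun do rewrite E.
split=> //; rewrite -cintegral_leb_cons//; under eq_cintegral do rewrite E.
rewrite -cintegral12//=; under eq_cintegral do rewrite cintegralZ//.
by rewrite cintegralZr// big_ord_recl Epr.
Qed.

Lemma leb_prod_real n (g : 'I_n -> R -> R) :
  (forall i, lambda.-integrable setT (EFin \o g i)) ->
  (leb n).-integrable setT (fun t => (\prod_i g i (tnth t i))%:E).
Proof.
move=> ig; have [|[+ _] _] := @leb_prod n (fun i x => (g i x)%:C).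
  move=> i; split=> /=; [exact: ig|exact: integrable0].
congr (_.-integrable _ _); apply/funext => t; congr (_%:E).
by rewrite -rmorph_prod.
Qed.

End lebesgue_n.

Section continuous_vec.
Context {R : realType} (n : nat).
Local Notation X := (measurableTypeR R).

(* An open set is the countable union of the cubes of side [1 / (k + 1)], cut out
   by the integer parts of [(k + 1) t_i], that it contains. *)
Lemma measurable_open_vec (V : set 'rV[R]_n) : open V ->
  measurable [set t : n.-tuple X | V (vec t)].
Proof.
move=> oV.
pose cube (kz : nat * 'rV[int]_n) : set (n.-tuple X) :=
  \bigcap_(i in [set: 'I_n])
    [set t | Num.floor (kz.1.+1%:R * (tnth t i : R)) == kz.2 0 i].
have mcube kz : measurable (cube kz).
  apply: fin_bigcap_measurable => // i _.
  have mi : measurable_fun setT (fun t : n.-tuple X => kz.1.+1%:R * (tnth t i : R)).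
    by apply: measurable_funM => //; exact: measurable_coord.
  rewrite (_ : mkset _ = (fun t : n.-tuple X => kz.1.+1%:R * (tnth t i : R)) @^-1`
      `[(kz.2 0 i)%:~R, (kz.2 0 i + 1)%:~R[%classic).
    by rewrite -[X in measurable X]setTI; exact: mi.
  by apply/seteqP; split => t /=; rewrite in_itv/= floor_eq.
rewrite (_ : mkset _ = \bigcup_kz
    (if `[< cube kz `<=` [set t | V (vec t)] >] then cube kz else set0)).
  apply: countable_bigcupT_measurable => // kz.
  by case: ifP.
apply/seteqP; split => [t /= Vt|t [kz _]]; last first.
  by case: ifPn => // /asboolP; exact.
have /nbhs_ballP[e /= e0 teV] : nbhs (vec t) V by exact: open_nbhs_nbhs.
have [k _ /(_ k (leqnn k)) ke] := near_infty_natSinv_lt (PosNum e0).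
exists (k, \row_i Num.floor (k.+1%:R * (tnth t i : R))) => //.
rewrite ifT; first by move=> i _ /=; rewrite mxE.
apply/asboolP => s st; apply: teV; split => // i j.
rewrite !ord1 !mxE /ball/=; apply: le_lt_trans ke.
have := st j I; rewrite /= mxE => /eqP st'.
have := floor_itv (k.+1%:R * (tnth t j : R)).
have := floor_itv (k.+1%:R * (tnth s j : R)).
rewrite st' => /andP[s1 s2] /andP[t1 t2].
have K0 : 0 < k.+1%:R :> R by [].
move: s1 s2 t1 t2; rewrite !intrD; set z : R := _%:~R; set K := k.+1%:R in K0 *.
move=> s1 s2 t1 t2; rewrite -[leLHS]mulr1 -(mulfV (lt0r_neq0 K0)) mulrA.
rewrite ler_pdivrMr// mulVf ?lt0r_neq0//.
rewrite -[X in _ * X](gtr0_norm K0) -normrM mulrBl ler_norml.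
by apply/andP; split; lra.
Qed.

(** The bridge between the topology of row vectors, in which Schwartz functions are continuous, and
    the product sigma-algebra on tuples, over which they are integrated. *)
Lemma measurable_continuous_vec (g : 'rV[R]_n -> R) : continuous g ->
  measurable_fun setT (fun t : n.-tuple X => g (vec t)).
Proof.
move=> /continuousP cg; apply: (measurability _ (RGenOpens.measurableE R)).
move=> _ [_ [a [b ->] <-]]; rewrite setTI.
by apply: (measurable_open_vec (V := g @^-1` `]a, b[)); apply: cg; exact: interval_open.
Qed.

End continuous_vec.

(** * Rapidly decreasing functions *)

Section inverse_quadratic.
Context {R : realType}.
Local Notation lambda := (@lebesgue_measure R).

Lemma integral_oneDsqrV : (\int[lambda]_x ((1 + x ^+ 2)^-1)%:E = pi%:E)%E.
Proof.
rewrite (@ge0_symfun_integralT _ (fun x => (1 + x ^+ 2)^-1)).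
- rewrite -set_itvcy integral0y_oneDsqr -EFinM; congr (_%:E).
  by rewrite mulrC divfK.
- by move=> x; rewrite invr_ge0 addr_ge0 ?sqr_ge0.
- exact: continuous_oneDsqrV.
- by move=> x /=; rewrite sqrrN.
Qed.

Lemma measurable_oneDsqrV :
  measurable_fun setT (fun x : measurableTypeR R => (1 + x ^+ 2)^-1).
Proof. by apply: continuous_measurable_fun; exact: continuous_oneDsqrV. Qed.

Lemma integrable_oneDsqrV :
  lambda.-integrable setT (EFin \o (fun x => (1 + x ^+ 2)^-1)).
Proof.
apply/integrableP; split.
  by apply/measurable_EFinP; exact: measurable_oneDsqrV.
rewrite (_ : integral _ _ _ = pi%:E) ?ltry// -integral_oneDsqrV.
apply: eq_integral => x _ /=.
by rewrite ger0_norm// invr_ge0 addr_ge0 ?sqr_ge0.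
Qed.

End inverse_quadratic.

Lemma prodr_le1 {R : realDomainType} (I : finType) (F : I -> R) :
  (forall i, 0 <= F i <= 1) -> \prod_i F i <= 1.
Proof.
move=> F01; rewrite [leRHS](_ : 1 = \prod_(i : I) 1); last by rewrite big1_eq.
by apply: ler_prod => i _; exact: F01.
Qed.

Section decay.
Context {R : realType} (n : nat).
Local Notation X := (measurableTypeR R).
Implicit Types x : 'rV[R]_n.

(** A product weight instead of a power of the norm: it factors over the coordinates, so its
    integral reduces to that of 1 / (1 + x^2). *)
Definition decay (N : nat) x : R := \prod_i ((1 + x 0 i ^+ 2) ^+ N)^-1.

Lemma decay_factor_gt0 (N : nat) (a : R) : 0 < (1 + a ^+ 2) ^+ N.
Proof. apply: exprn_gt0; apply: ltr_pwDl => //; exact: sqr_ge0. Qed.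

Lemma decay_gt0 N x : 0 < decay N x.
Proof. by apply: prodr_gt0 => i _; rewrite invr_gt0 decay_factor_gt0. Qed.

Lemma decay_le1 N (x : 'rV[R]_n) : decay N x <= 1.
Proof.
apply: prodr_le1 => i; rewrite invr_ge0 ltW ?decay_factor_gt0//=.
by rewrite invf_le1 ?decay_factor_gt0// exprn_ege1// lerDl sqr_ge0.
Qed.

Lemma integrable_decay :
  (leb n).-integrable setT (fun t : n.-tuple X => (decay 1 (vec t))%:E).
Proof.
have := @leb_prod_real R n (fun=> fun x : R => (1 + x ^+ 2)^-1).
move=> /(_ (fun=> integrable_oneDsqrV)); congr (_.-integrable _ _).
by apply/funext => t; congr (_%:E); apply: eq_bigr => i _; rewrite mxE expr1.
Qed.

(* At [x] one uses the exponent [2 N] for the coordinates with [`|x_i| > 1] only;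
   there are finitely many such choices. *)
Lemma decay_bound (h : 'rV[R]_n -> R) : (forall x, 0 <= h x) ->
  (forall alpha, exists K, forall x, `|monomial alpha x| * h x <= K) ->
  forall N, exists2 K : R, 0 <= K & forall x, h x <= K * decay N x.
Proof.
move=> h0 /choice[K_ hK] N.
pose al (S : {set 'I_n}) : {ffun 'I_n -> nat} :=
  [ffun i => if i \in S then (2 * N)%N else 0%N].
(* Each coordinate costs 2^N, because 1 + a^2 <= 2 max(1, a^2); the sum over all [S] makes the
   constant independent of the set selected at [x]. *)
exists ((2 ^+ N) ^+ n * \sum_S `|K_ (al S)|).
  by rewrite mulr_ge0 ?exprn_ge0// sumr_ge0.
move=> x; pose S := finset (fun i => 1 < `|x 0 i|).
have le1 : \prod_i (1 + x 0 i ^+ 2) ^+ N <= (2 ^+ N) ^+ n * `|monomial (al S) x|.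
  rewrite /monomial normr_prod (_ : _ ^+ n = \prod_(i < n) 2 ^+ N) -?big_split/=; last first.
    by rewrite prodr_const card_ord.
  apply: ler_prod => i _; rewrite ltW ?decay_factor_gt0//= ffunE inE.
  have x2 : `|x 0 i| ^+ 2 = x 0 i ^+ 2 by rewrite real_normK ?num_real.
  case: ltP => xi.
    rewrite normrX exprM -exprMn x2; apply: lerXn2r; rewrite ?nnegrE.
    - by rewrite addr_ge0 ?sqr_ge0.
    - by rewrite mulr_ge0 ?sqr_ge0.
    - by rewrite mulrDl mul1r lerD2r -x2 expr_ge1// ltW.
  rewrite expr0 normr1 mulr1 lerXn2r ?nnegrE ?addr_ge0 ?sqr_ge0//.
  by rewrite -[leRHS]/(1 + 1) lerD2l -x2 expr_le1.
have -> : decay N x = (\prod_i (1 + x 0 i ^+ 2) ^+ N)^-1.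
  by rewrite /decay -prodfV.
rewrite ler_pdivlMr; last by apply: prodr_gt0 => i _; exact: decay_factor_gt0.
rewrite mulrC; apply: (le_trans (ler_wpM2r (h0 x) le1)).
rewrite -mulrA ler_wpM2l ?exprn_ge0//; apply: (le_trans (hK _ x)).
apply: (le_trans (ler_norm _)).
by rewrite (bigD1 S)//= lerDl sumr_ge0.
Qed.

End decay.

(** [smooth] speaks of lists of directions, the seminorms of multi-indices. The list is independent
    of [f], so the same one serves a function and its conjugate. *)
Lemma multi_partial_foldr {R : realType} n (beta : {ffun 'I_n -> nat}) :
  exists s, forall f : 'rV[R]_n -> R[i],
    multi_partial beta f = foldr (@partial R n) f s.
Proof.
rewrite /multi_partial; elim: (enum 'I_n) => [|i r [s IH]] /=; first by exists [::].
exists (nseq (beta i) i ++ s) => f; rewrite foldr_cat IH.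
by elim: (beta i) => //= m ->.
Qed.

Section schwartz_chain.
Context {R : realType} (n : nat).
Local Notation normc := (@Normc.normc R).
Variables (f : 'rV[R]_n -> R[i]) (f_S : schwartz f).

Lemma schwartz_bound alpha beta : exists K, forall x,
  `|monomial alpha x| * normc (multi_partial beta f x) <= K.
Proof.
have := f_S.2 alpha beta; rewrite /schwartz_seminorm.
set s := ereal_sup _ => soo.
have ub x : ((`|monomial alpha x| * normc (multi_partial beta f x))%:E <= s)%E.
  by apply: ereal_sup_ubound; exists x.
have s0 : (0 <= s)%E.
  by apply: le_trans (ub 0); rewrite lee_fin mulr_ge0// normc_ge0.
exists (fine s) => x; rewrite -lee_fin fineK//.
by rewrite ge0_fin_numE.
Qed.

Lemma schwartz_differentiable beta x :
  differentiable (fun y => complex.Re (multi_partial beta f y)) x /\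
  differentiable (fun y => complex.Im (multi_partial beta f y)) x.
Proof. by have [s ->] := @multi_partial_foldr R n beta; exact: f_S.1. Qed.

Lemma schwartz_decay beta N : exists2 K : R, 0 <= K &
  forall x, normc (multi_partial beta f x) <= K * decay N x.
Proof.
apply: decay_bound => [x|alpha]; first exact: normc_ge0.
exact: schwartz_bound.
Qed.

Lemma schwartz_cmeasurable beta :
  cmeasurable (fun t : n.-tuple (measurableTypeR R) => multi_partial beta f (vec t)).
Proof.
split.
  apply: (measurable_continuous_vec (g := fun y => complex.Re (multi_partial beta f y))).
  by move=> x; apply: differentiable_continuous; exact: (schwartz_differentiable _ _).1.
apply: (measurable_continuous_vec (g := fun y => complex.Im (multi_partial beta f y))).
by move=> x; apply: differentiable_continuous; exact: (schwartz_differentiable _ _).2.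
Qed.

Lemma multi_partial0 : multi_partial [ffun=> 0%N] f = f.
Proof. by rewrite /multi_partial; elim: (enum _) => //= i r ->; rewrite ffunE. Qed.

(* [multi_partial] differentiates in a fixed order.  The partial results of this
   process are again of the form [multi_partial beta' f], so that the seminorms
   control them without commuting partial derivatives. *)
Lemma multi_partial_suffix beta p i s m : enum 'I_n = p ++ i :: s ->
  iter m (partial i) (foldr (fun i g => iter (beta i) (partial i) g) f s) =
  multi_partial [ffun j => if j \in p then 0%N else if j == i then m else beta j] f.
Proof.
move=> eps; rewrite /multi_partial; set b := finfun _.
have up : uniq (p ++ i :: s) by rewrite -eps enum_uniq.
move: up; rewrite cat_uniq /= => /and3P[_ /norP[ip sp] /andP[is_ _]].
rewrite eps foldr_cat /= {2}/b ffunE (negbTE ip) eqxx.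
have -> : foldr (fun i g => iter (b i) (partial i) g) f s =
    foldr (fun i g => iter (beta i) (partial i) g) f s.
  elim: s sp is_ {eps} => //= j s IH /norP[jp sp].
  rewrite inE => /norP[ij is_]; rewrite IH//.
  by rewrite /b ffunE (negbTE jp) eq_sym (negbTE ij).
(* The coordinates in [p] carry exponent 0 and act as the identity. The induction consumes one copy
   of [p], while [b] keeps referring to the whole list. *)
have : {subset p <= p} by [].
elim: {1 3}p => //= j q IH jq; rewrite -IH; last first.
  by move=> k kq; apply: jq; rewrite inE kq orbT.
by rewrite /b ffunE jq// mem_head.
Qed.

End schwartz_chain.

(** * The Fourier transform of a Schwartz function *)

Section complex_dominated_convergence.
Context {R : realType} d (T : measurableType d).
Variable mu : {measure set T -> \bar R}.
Local Notation normc := (@Normc.normc R).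

Lemma cdominated_convergence (F_ : nat -> T -> R[i]) (F : T -> R[i]) (G : T -> R) :
  (forall k, cmeasurable (F_ k)) -> cmeasurable F ->
  mu.-integrable setT (EFin \o G) -> (forall k x, normc (F_ k x) <= G x) ->
  (forall x, complex.Re (F_ k x) @[k --> \oo] --> complex.Re (F x)) ->
  (forall x, complex.Im (F_ k x) @[k --> \oo] --> complex.Im (F x)) ->
  complex.Re (cintegral mu setT (F_ k)) @[k --> \oo] -->
    complex.Re (cintegral mu setT F) /\
  complex.Im (cintegral mu setT (F_ k)) @[k --> \oo] -->
    complex.Im (cintegral mu setT F).
Proof.
move=> mF_ mF iG F_G cRe cIm.
have dct (f_ : nat -> T -> R) (f : T -> R) :
    (forall k, measurable_fun setT (f_ k)) -> measurable_fun setT f ->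
    (forall k x, `|f_ k x| <= G x) -> (forall x, f_ k x @[k --> \oo] --> f x) ->
    (\int[mu]_x f_ k x) @[k --> \oo] --> \int[mu]_x f x.
  move=> mf_ mf f_G cf.
  have [intf _ cvgf] : [/\ mu.-integrable setT (EFin \o f),
      [sequence \int[mu]_x `|(f_ k x)%:E - (f x)%:E| ]_k @ \oo --> 0%E &
      [sequence \int[mu]_x (f_ k x)%:E]_k @ \oo --> \int[mu]_x (f x)%:E]%E.
    apply: (dominated_convergence measurableT _ _ _ iG).
    - by move=> k; apply/measurable_EFinP.
    - by apply/measurable_EFinP.
    - by apply: aeW => x _; apply/fine_cvgP; split; [exact: nearW|exact: cf].
    - by apply: aeW => x k _; rewrite lee_fin.
  suff : (\int[mu]_x (f_ k x)%:E)%E @[k --> \oo] --> (\int[mu]_x f x)%:E.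
    by move/fine_cvg.
  by rewrite /Rintegral fineK//; exact: integrable_fin_num.
split.
  apply: dct => //.
  - by move=> k; exact: (mF_ k).1.
  - exact: mF.1.
  - by move=> k x; exact: (le_trans (normRe_le _)).
apply: dct => //.
- by move=> k; exact: (mF_ k).2.
- exact: mF.2.
- by move=> k x; exact: (le_trans (normIm_le _)).
Qed.

End complex_dominated_convergence.

Section directional_derivative.
Context {R : realType} (V : normedModType R).
Variables (G : V -> R) (e : V).
Hypothesis dG : forall x, derivable G x e.

(** The derivative as a limit along the sequence 1 / (k + 1), the form in which dominated
    convergence can use it. *)
Lemma cvg_difference_quotient y :
  (harmonic k)^-1 * (G (y + harmonic k *: e) - G y) @[k --> \oo] --> 'D_e G y.
Proof.
have h0 : harmonic k @[k --> \oo] --> (0 : R)^'.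
  move=> A hA; have : \forall k \near \oo, harmonic k != 0 :> R -> A (harmonic k).
    exact: (@cvg_harmonic R _ hA).
  by apply: filterS => k; apply; apply: lt0r_neq0; exact: harmonic_gt0.
have dGe := @dG y; have := cvg_comp _ _ h0 dGe; rewrite -/('D_e G y).
by under eq_fun => k do rewrite /= [_ *: e + y]addrC.
Qed.

Lemma is_derive_along y (t : R) :
  is_derive t 1 (fun s => G (y + s *: e)) ('D_e G (y + t *: e)).
Proof.
have E : (fun h : R => h^-1 *: (((fun s => G (y + s *: e)) \o shift t) (h *: 1) -
    G (y + t *: e))) =
  (fun h => h^-1 *: ((G \o shift (y + t *: e)) (h *: e) - G (y + t *: e))).
  apply/funext => h /=; congr (_ *: (G _ - _)).
  by rewrite [h *: 1]mulr1 scalerDl addrCA addrC -addrA.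
by have dGe := @dG (y + t *: e); constructor; [rewrite /derivable E|rewrite /derive E].
Qed.

(** The mean value theorem on the segment from y to y + h e. The bound does not depend on h, as a
    dominating function requires. *)
Lemma difference_quotient_le y (h B : R) : 0 < h <= 1 ->
  (forall s, 0 <= s <= 1 -> `|'D_e G (y + s *: e)| <= B) ->
  `|h^-1 * (G (y + h *: e) - G y)| <= B.
Proof.
move=> /andP[h0 h1] DB.
have [c + E] := @MVT_segment R (fun s => G (y + s *: e))
  (fun s => 'D_e G (y + s *: e)) 0 h (ltW h0) (fun s _ => is_derive_along y s)
  (derivable_within_continuous (fun s _ => @ex_derive _ _ _ _ _ _ _ (is_derive_along y s))).
rewrite in_itv/= => /andP[c0 ch].
move: E; rewrite scale0r addr0 subr0 => ->.
by rewrite mulrC mulfK ?lt0r_neq0// DB// c0 (le_trans ch).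
Qed.

End directional_derivative.

Section fourier_transform.
Context {R : realType} (n : nat).
Local Notation X := (measurableTypeR R).
Local Notation normc := (@Normc.normc R).
Implicit Types (f g : 'rV[R]_n -> R[i]) (w x y : 'rV[R]_n).

Definition fourierRn f w := integralRn (fun x => f x * expi (- dot x w)).

Lemma dotC x y : dot x y = dot y x.
Proof. by apply: eq_bigr => i _; rewrite mulrC. Qed.

Lemma dotDl x y w : dot (x + y) w = dot x w + dot y w.
Proof. by rewrite -big_split; apply: eq_bigr => i _; rewrite mxE mulrDl. Qed.

Lemma dotZl (a : R) x w : dot (a *: x) w = a * dot x w.
Proof. by rewrite mulr_sumr; apply: eq_bigr => i _; rewrite mxE mulrA. Qed.

Lemma dot_delta i w : dot (delta_mx 0 i) w = w 0 i.
Proof.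
rewrite /dot (bigD1 i)//= big1 ?mxE ?eqxx ?mul1r ?addr0// => j ji.
by rewrite mxE (negbTE ji) mul0r.
Qed.

Lemma vec_taffine (s : R) (a : 'rV[R]_n) (t : n.-tuple X) :
  vec (taffine s (a 0) t) = s *: vec t + a.
Proof. by apply/rowP => i; rewrite !mxE tnth_mktuple. Qed.

Lemma measurable_dot_vec w : measurable_fun setT (fun t : n.-tuple X => dot (vec t) w).
Proof.
rewrite /dot; under eq_fun do under eq_bigr do rewrite mxE.
apply: measurable_sum => i; apply: measurable_funM => //.
exact: measurable_coord.
Qed.

Lemma cintegrable_decay_le f K : cmeasurable (fun t : n.-tuple X => f (vec t)) ->
  (forall x, normc (f x) <= K * decay 1 x) ->
  cintegrable (leb n) setT (fun t => f (vec t)).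
Proof.
move=> mf fK; apply: (cintegrable_le mf (g := fun t => K * decay 1 (vec t))) => //.
have := integrableZl measurableT K (@integrable_decay R n).
by apply: eq_integrable => // t _ /=; rewrite EFinM.
Qed.

Lemma cintegrable_modulation f (r : n.-tuple X -> R) :
  measurable_fun setT r ->
  cintegrable (leb n) setT (fun t => f (vec t)) ->
  cintegrable (leb n) setT (fun t => f (vec t) * expi (r t)).
Proof.
move=> mr intf; under eq_fun do rewrite mulrC.
apply: (cintegrableM_bounded (K := 1)) => //; first exact: cmeasurable_expi.
by move=> t; rewrite normc_expi.
Qed.

Lemma fourierRn_translate f (a w : 'rV[R]_n) :
  cintegrable (leb n) setT (fun t => f (vec t)) ->
  cintegrable (leb n) setT (fun t => f (vec t + a)) /\
  integralRn (fun y => f (y + a) * expi (- dot y w)) =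
    expi (dot a w) * fourierRn f w.
Proof.
move=> intf.
have Ev t : vec t + a = vec (taffine 1 (a 0) t) by rewrite vec_taffine scale1r.
split.
  under eq_fun do rewrite Ev.
  exact: (cintegrable_taffine _ (oner_neq0 _) intf).
rewrite /fourierRn /integralRn -cintegralZ; last first.
  apply: cintegrable_modulation => //; apply: measurableT_comp => //.
  exact: measurable_dot_vec.
rewrite -[RHS]mul1r [in X in X * _](_ : 1 = (`|1|^-1 ^+ n)%:C :> R[i]); last first.
  by rewrite normr1 invr1 expr1n.
rewrite -(cintegral_taffine (a 0) (oner_neq0 _)); last first.
  apply/cintegrableZ/cintegrable_modulation => //; apply: measurableT_comp => //.
  exact: measurable_dot_vec.
apply: eq_cintegral => t _; rewrite Ev mulrCA -expiD; congr (_ * expi _).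
by rewrite -Ev dotDl; ring.
Qed.

(** For |b| <= 1 one has 1 + a^2 <= 4 (1 + (a + b)^2). The factor 4 is granted to every coordinate,
    although only the [i]-th one moves. *)
Lemma decay_shift i (s : R) y : 0 <= s <= 1 ->
  decay 1 (y + s *: delta_mx 0 i) <= 4 ^+ n * decay 1 y.
Proof.
move=> /andP[s0 s1]; rewrite (_ : 4 ^+ n = \prod_(j < n) 4); last first.
  by rewrite prodr_const card_ord.
rewrite -big_split; apply: ler_prod => j _; rewrite !expr1 !mxE eqxx/=.
set a := y 0 j; set b := s * _.
have b2 : b ^+ 2 <= 1.
  by rewrite expr_le1// /b; case: (_ == _); rewrite ?mulr1 ?mulr0.
have p1 : 0 < 1 + (a + b) ^+ 2 by rewrite ltr_pwDl ?sqr_ge0.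
have p2 : 0 < 1 + a ^+ 2 by rewrite ltr_pwDl ?sqr_ge0.
rewrite invr_ge0 ltW//= ler_pdivlMr// mulrC ler_pdivrMr//.
have := sqr_ge0 (a + 2 * b); nra.
Qed.

End fourier_transform.

Lemma dotBr {R : realType} n (w x y : 'rV[R]_n) :
  dot w (x - y) = dot w x - dot w y.
Proof. by rewrite /dot -sumrB; apply: eq_bigr => i _; rewrite !mxE mulrBr. Qed.

Section scaled_trigo.
Context {R : realType}.

Let is_derive_scale (c x : R) : is_derive x 1 (fun s : R => s * c) c.
Proof.
have := is_deriveZ c (is_derive_id x (1 : R)).
rewrite [c *: 1]mulr1; congr is_derive.
by apply/funext => s; rewrite /= mulrC.
Qed.

Lemma is_derive_cosM (c x : R) :
  is_derive x 1 (fun s : R => cos (s * c)) (- sin (x * c) * c).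
Proof.
exact: (is_derive1_comp (g := fun s => s * c) (x := x)
  (is_derive_cos (x * c)) (is_derive_scale c x)).
Qed.

Lemma is_derive_sinM (c x : R) :
  is_derive x 1 (fun s : R => sin (s * c)) (cos (x * c) * c).
Proof.
exact: (is_derive1_comp (g := fun s => s * c) (x := x)
  (is_derive_sin (x * c)) (is_derive_scale c x)).
Qed.

End scaled_trigo.

Section fourier_derivative.
Context {R : realType} (n : nat).
Local Notation X := (measurableTypeR R).
Local Notation normc := (@Normc.normc R).
Variables (g : 'rV[R]_n -> R[i]) (i : 'I_n) (K K' : R).
(** The assumptions concern [g] and a single partial derivative, so they can be checked for every
    intermediate function of an iterated derivative. *)
Hypothesis g_diff : forall x,
  differentiable (fun y => complex.Re (g y)) x /\
  differentiable (fun y => complex.Im (g y)) x.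
Hypothesis g_meas : cmeasurable (fun t : n.-tuple X => g (vec t)).
Hypothesis dg_meas : cmeasurable (fun t : n.-tuple X => partial i g (vec t)).
Hypothesis g_decay : forall x, normc (g x) <= K * decay 1 x.
Hypothesis dg_decay : forall x, normc (partial i g x) <= K' * decay 1 x.

Let e : 'rV[R]_n := delta_mx 0 i.
Let quo (h : R) (y : 'rV[R]_n) : R[i] := (h^-1)%:C * (g (y + h *: e) - g y).

Let dRe x : derivable (fun y => complex.Re (g y)) x e.
Proof. by apply: diff_derivable; exact: (g_diff x).1. Qed.

Let dIm x : derivable (fun y => complex.Im (g y)) x e.
Proof. by apply: diff_derivable; exact: (g_diff x).2. Qed.

(** The dominating function for h -> 0: the mean value theorem leads to the derivative at points
    within distance one of y, where [decay] has lost at most 4^n. The 2 accounts for real and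
    imaginary parts. *)
Let quo_le h y : 0 < h <= 1 -> normc (quo h y) <= 2 * (K' * 4 ^+ n * decay 1 y).
Proof.
move=> h01; apply: (le_trans (normc_leD _)); rewrite mulrDl mul1r.
have dK s : 0 <= s <= 1 ->
    normc (partial i g (y + s *: e)) <= K' * 4 ^+ n * decay 1 y.
  move=> s01; apply: (le_trans (dg_decay _)).
  have K'0 : 0 <= K'.
    rewrite -(pmulr_lge0 _ (decay_gt0 1 (0 : 'rV[R]_n))).
    by rewrite (le_trans _ (dg_decay 0))// normc_ge0.
  by rewrite -mulrA ler_wpM2l// decay_shift.
rewrite /quo complexRe_M complexIm_M /= !mul0r subr0 addr0 complexRe_B complexIm_B.
apply: lerD.
  apply: (difference_quotient_le (G := fun y => complex.Re (g y))) => //.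
  by move=> s /dK; apply: le_trans; exact: (normRe_le (partial i g (y + s *: e))).
apply: (difference_quotient_le (G := fun y => complex.Im (g y))) => //.
by move=> s /dK; apply: le_trans; exact: (normIm_le (partial i g (y + s *: e))).
Qed.

(* Instead of integrating by parts in the [i]-th coordinate, let [h -> 0] in the
   transform of [(g (y + h e_i) - g y) / h], which is [(e^(i h w_i) - 1) / h]
   times that of [g] by translation invariance. *)
Lemma fourierRn_partial w :
  fourierRn (partial i g) w = (0 +i* w 0 i) * fourierRn g w.
Proof.
have ig := cintegrable_decay_le g_meas g_decay.
have mdot : measurable_fun setT (fun t : n.-tuple X => - dot (vec t) w).
  by apply: measurableT_comp => //; exact: measurable_dot_vec.
have h01 k : 0 < (harmonic k : R) <= 1.
  by rewrite harmonic_gt0 /= invf_le1// ler1n.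
pose h (k : nat) : R := harmonic k.
have mq k : cmeasurable (fun t : n.-tuple X => quo (h k) (vec t)).
  apply: cmeasurableM; first exact: cmeasurable_cst.
  apply: (@cintegrable_measurable _ _ _ (leb n)); apply: cintegrableB => //.
  exact: (fourierRn_translate _ w ig).1.
have lhs := @cdominated_convergence R _ _ (leb n)
  (fun k t => quo (h k) (vec t) * expi (- dot (vec t) w))
  (fun t => partial i g (vec t) * expi (- dot (vec t) w))
  (fun t => 2 * (K' * 4 ^+ n * decay 1 (vec t))).
have {lhs}[||||t|t|lRe lIm] := lhs.
- by move=> k; apply: cmeasurableM => //; exact: cmeasurable_expi.
- by apply: cmeasurableM => //; exact: cmeasurable_expi.
- have := integrableZl measurableT (2 * (K' * 4 ^+ n)) (@integrable_decay R n).
  by apply: eq_integrable => // t _ /=; rewrite EFinM mulrA.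
- by move=> k t; rewrite normcM_expi quo_le.
- have cRe := @cvg_difference_quotient R _ _ e dRe (vec t).
  have cIm := @cvg_difference_quotient R _ _ e dIm (vec t).
  rewrite complexRe_M.
  under eq_fun do rewrite complexRe_M /quo complexRe_M complexIm_M /= !mul0r subr0
    addr0 complexRe_B complexIm_B.
  by apply: cvgB; apply: cvgMr_tmp.
- have cRe := @cvg_difference_quotient R _ _ e dRe (vec t).
  have cIm := @cvg_difference_quotient R _ _ e dIm (vec t).
  rewrite complexIm_M.
  under eq_fun do rewrite complexIm_M /quo complexRe_M complexIm_M /= !mul0r subr0
    addr0 complexRe_B complexIm_B.
  by apply: cvgD; apply: cvgMr_tmp.
have E k : cintegral (leb n) setT
    (fun t => quo (h k) (vec t) * expi (- dot (vec t) w)) =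
    ((h k)^-1)%:C * ((expi (h k * w 0 i) - 1) * fourierRn g w).
  have [i1 t1] := fourierRn_translate (h k *: e) w ig.
  rewrite mulrBl mul1r -dot_delta -dotZl -t1 /fourierRn /integralRn.
  rewrite -cintegralB//; last 2 first.
  - exact: (cintegrable_modulation (f := fun y => g (y + h k *: e))).
  - exact: cintegrable_modulation.
  rewrite -cintegralZ.
    by apply: eq_cintegral => t _; rewrite /quo -mulrA mulrBl.
  apply: cintegrableB; last exact: cintegrable_modulation.
  exact: (cintegrable_modulation (f := fun y => g (y + h k *: e))).
(* This limit and the next are the derivatives of cos (s w_i) and sin (s w_i) at s = 0; together
   they say that (e^(i h w_i) - 1) / h tends to i w_i. *)
have cc : (h k)^-1 * (cos (h k * w 0 i) - 1) @[k --> \oo] --> (0 : R).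
  have dcos (x : R) : is_derive x 1 (fun s : R => cos (s * w 0 i)) (- sin (x * w 0 i) * w 0 i).
    exact: is_derive_cosM.
  have := @cvg_difference_quotient R R^o (fun s : R => cos (s * w 0 i)) 1
    (fun x => @ex_derive _ _ _ _ _ _ _ (dcos x)) 0.
  rewrite derive_val mul0r sin0 oppr0 mul0r.
  by under eq_fun => k do rewrite cos0 add0r [_ *: _]mulr1.
have cs : (h k)^-1 * sin (h k * w 0 i) @[k --> \oo] --> w 0 i.
  have dsin (x : R) : is_derive x 1 (fun s : R => sin (s * w 0 i)) (cos (x * w 0 i) * w 0 i).
    exact: is_derive_sinM.
  have := @cvg_difference_quotient R R^o (fun s : R => sin (s * w 0 i)) 1
    (fun x => @ex_derive _ _ _ _ _ _ _ (dsin x)) 0.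
  rewrite derive_val mul0r cos0 mul1r.
  by under eq_fun => k do rewrite sin0 subr0 add0r [_ *: _]mulr1.
have lRe' : complex.Re (((h k)^-1)%:C * ((expi (h k * w 0 i) - 1) * fourierRn g w))
    @[k --> \oo] --> complex.Re (fourierRn (partial i g) w).
  by under eq_fun do rewrite -E.
have lIm' : complex.Im (((h k)^-1)%:C * ((expi (h k * w 0 i) - 1) * fourierRn g w))
    @[k --> \oo] --> complex.Im (fourierRn (partial i g) w).
  by under eq_fun do rewrite -E.
have Er k : complex.Re (((h k)^-1)%:C * (expi (h k * w 0 i) - 1)) =
    (h k)^-1 * (cos (h k * w 0 i) - 1).
  by rewrite complexRe_M complexRe_B /= mul0r subr0.
have Ei k : complex.Im (((h k)^-1)%:C * (expi (h k * w 0 i) - 1)) =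
    (h k)^-1 * sin (h k * w 0 i).
  by rewrite complexIm_M complexIm_B /= mul0r subr0 addr0.
apply: complex_ext.
  rewrite -(cvg_lim _ lRe')//; apply: cvg_lim => //; rewrite complexRe_M.
  under eq_fun do rewrite mulrA complexRe_M Er Ei.
  by apply: cvgB; apply: cvgMr_tmp.
rewrite -(cvg_lim _ lIm')//; apply: cvg_lim => //; rewrite complexIm_M.
under eq_fun do rewrite mulrA complexIm_M Er Ei.
by apply: cvgD; apply: cvgMr_tmp.
Qed.

End fourier_derivative.

Section fourier_decay.
Context {R : realType} (n : nat).
Local Notation X := (measurableTypeR R).
Local Notation normc := (@Normc.normc R).
Variables (f : 'rV[R]_n -> R[i]) (f_S : schwartz f).

Lemma schwartz_cintegrable beta :
  cintegrable (leb n) setT (fun t => multi_partial beta f (vec t)).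
Proof.
have [K _ fK] := schwartz_decay f_S beta 1.
exact: (cintegrable_decay_le (schwartz_cmeasurable f_S beta) fK).
Qed.

(** Each differentiation multiplies the transform by i w_i, of modulus |w_i|. The induction runs
    over the list of coordinates and, inside it, over the exponent of the current one. *)
Lemma normc_fourierRn_multi_partial beta w :
  normc (fourierRn (multi_partial beta f) w) =
  `|monomial beta w| * normc (fourierRn f w).
Proof.
rewrite /monomial normr_prod; under eq_bigr do rewrite normrX.
rewrite -(big_enum _ _ _ (fun i => `|w 0 i| ^+ beta i)) /multi_partial.
(* Recording that the remaining list is a suffix of [enum] lets [multi_partial_suffix] recognise
   each intermediate function as a derivative of [f] with controlled seminorms. *)
have : exists p, enum 'I_n = p ++ enum 'I_n by exists [::].
elim: {2 3 4}(enum 'I_n) => [|i s IHs] [p ep].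
  by rewrite big_nil mul1r.
rewrite big_cons -mulrA -IHs; last by exists (rcons p i); rewrite cat_rcons.
rewrite [foldr _ _ _]/=; elim: (beta i) => [|m IHm]; first by rewrite mul1r.
have Em := multi_partial_suffix f beta m ep.
have ESm := multi_partial_suffix f beta m.+1 ep.
rewrite exprS -mulrA -IHm [iter _ _ _]/=.
set g := iter m _ _ in Em ESm *.
rewrite iterS -/g in ESm.
have [K _ gK] := schwartz_decay f_S
  [ffun j => if j \in p then 0%N else if j == i then m else beta j] 1.
have [K' _ dgK] := schwartz_decay f_S
  [ffun j => if j \in p then 0%N else if j == i then m.+1 else beta j] 1.
rewrite -Em in gK; rewrite -ESm in dgK.
rewrite (fourierRn_partial _ _ _ gK dgK).
- by rewrite Normc.normcM /= expr0n add0r sqrtr_sqr.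
- by rewrite Em; exact: schwartz_differentiable.
- by rewrite Em; exact: schwartz_cmeasurable.
- by rewrite ESm; exact: schwartz_cmeasurable.
Qed.

(** A monomial times the transform has the modulus of the transform of a derivative, which is
    bounded by its L^1 norm; [decay_bound] turns these bounds into decay. *)
Lemma fourierRn_decay N : exists2 K : R, 0 <= K &
  forall w, normc (fourierRn f w) <= K * decay N w.
Proof.
apply: decay_bound => [w|beta]; first exact: normc_ge0.
exists (2 * \int[leb n]_t normc (multi_partial beta f (vec t))) => w.
rewrite -normc_fourierRn_multi_partial.
have mdot : measurable_fun setT (fun t : n.-tuple X => - dot (vec t) w).
  by apply: measurableT_comp => //; exact: measurable_dot_vec.
have := normc_cintegral_le (cintegrable_modulation mdot (schwartz_cintegrable beta)).
by under eq_Rintegral do rewrite normcM_expi.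
Qed.

End fourier_decay.

Section fourier_measurable.
Context {R : realType} (n : nat).
Local Notation X := (measurableTypeR R).
Local Notation normc := (@Normc.normc R).

Lemma measurable_dot2 :
  measurable_fun setT (fun p : n.-tuple X * n.-tuple X => dot (vec p.1) (vec p.2)).
Proof.
rewrite /dot; under eq_fun do under eq_bigr do rewrite !mxE.
apply: measurable_sum => i; apply: measurable_funM.
  by apply: (measurableT_comp (@measurable_coord R n i)).
by apply: (measurableT_comp (@measurable_coord R n i)).
Qed.

Lemma measurable_decay N : measurable_fun setT (fun t : n.-tuple X => decay N (vec t)).
Proof.
rewrite /decay; under eq_fun do under eq_bigr do rewrite mxE.
apply: measurable_prod => i _.
apply: (measurableT_comp (@measurable_inv R)); apply: measurable_funX.
by apply: measurable_funD => //; apply: measurable_funX; exact: measurable_coord.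
Qed.

(** Fubini makes the partial integral of a jointly integrable function measurable, but f(y) e^(-i
    y.w) has no decay in w. The weight [decay 1] in w supplies it and, being positive, is divided
    out again. *)
Lemma cmeasurable_fourierRn (f : 'rV[R]_n -> R[i]) :
  cintegrable (leb n) setT (fun t => f (vec t)) ->
  cmeasurable (fun t : n.-tuple X => fourierRn f (vec t)).
Proof.
move=> intf; have mf := cintegrable_measurable intf.
pose g (p : n.-tuple X * n.-tuple X) : R[i] :=
  (decay 1 (vec p.1))%:C * (f (vec p.2) * expi (- dot (vec p.2) (vec p.1))).
have mE : measurable_fun setT
    (fun p : n.-tuple X * n.-tuple X => - dot (vec p.2) (vec p.1)).
  by apply: measurableT_comp => //; under eq_fun do rewrite dotC; exact: measurable_dot2.
have intg : cintegrable (leb n \x leb n)%E setT g.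
  apply: (cintegrable_prodM_le _ (@integrable_decay R n) (cintegrable_normc intf)).
    apply: cmeasurableM.
      by apply: cmeasurable_real; apply: (measurableT_comp (measurable_decay 1)).
    apply: cmeasurableM; last exact: cmeasurable_expi.
    exact: (cmeasurable_comp _ mf).
  by move=> s t; rewrite Normc.normcM normcM_expi normc_real gtr0_norm ?decay_gt0.
have := cintegrable_measurable (cintegrable_cintegral intg).
have -> : (fun s => cintegral (leb n) setT (fun t => g (s, t))) =
    (fun s => (decay 1 (vec s))%:C * fourierRn f (vec s)).
  apply/funext => s; rewrite /g /= cintegralZ//.
  apply: cintegrable_modulation => //; apply: measurableT_comp => //.
  exact: measurable_dot_vec.
move=> mg; rewrite (_ : (fun t => _) = fun t : n.-tuple X =>
   ((decay 1 (vec t))^-1)%:C * ((decay 1 (vec t))%:C * fourierRn f (vec t))).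
  apply: cmeasurableM => //; apply: cmeasurable_real.
  exact: (measurableT_comp (@measurable_inv R) (measurable_decay 1)).
apply/funext => t; rewrite mulrA -rmorphM mulVf ?mul1r//.
exact/lt0r_neq0/decay_gt0.
Qed.

End fourier_measurable.

(** * Fourier inversion by the Poisson kernel *)

Section poisson_kernel.
Context {R : realType}.
Local Notation lambda := (@lebesgue_measure R).
Local Notation X := (measurableTypeR R).
Local Notation normc := (@Normc.normc R).

(** The convergence factor of the inversion formula: its transform 2 / (1 + t^2), the Poisson
    kernel, comes from an elementary primitive and has an arctangent as its own primitive. *)
Definition expNabs (w : R) : R := expR (- `|w|).

Lemma continuous_expNabs : continuous expNabs.
Proof.
move=> x; apply: (@continuous_comp _ _ _ (fun w : R => - `|w|) expR).
  by apply: cvgN; exact: norm_continuous.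
exact: continuous_expR.
Qed.

Lemma expNabs_ge0 w : 0 <= expNabs w. Proof. exact: expR_ge0. Qed.

Lemma expNabs_le1 w : expNabs w <= 1.
Proof. by rewrite -expR0 ler_expR oppr_le0. Qed.

(* The summand [1] makes the integrand nonnegative, as the fundamental theorem of
   calculus on a half-line requires. *)
Let c (t w : R) := expNabs w * (1 + cos (w * t)).

Let c_ge0 t w : 0 <= c t w.
Proof. by rewrite mulr_ge0 ?expNabs_ge0// -lerBlDl sub0r cos_geN1. Qed.

Let continuous_c t : continuous (c t).
Proof.
move=> x; apply: cvgM; first exact: continuous_expNabs.
apply: cvgD; first exact: cvg_cst.
apply: (@continuous_comp _ _ _ (fun w : R => w * t) (@cos R)).
  by apply: cvgMr_tmp; exact: cvg_id.
exact: continuous_cos.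
Qed.

(** A primitive of [c t] on w >= 0: e^(-w) (t sin (w t) - cos (w t)) / (1 + t^2) is a primitive of
    e^(-w) cos (w t), and -e^(-w) is one of e^(-w). *)
Let F (t w : R) :=
  expR (- w) * ((1 + t ^+ 2)^-1 * (t * sin (w * t) - cos (w * t)) - 1).

Let dF (t w : R) : is_derive w 1 (F t) (expR (- w) * (1 + cos (w * t))).
Proof.
have d1 : is_derive w 1 (fun s : R => expR (- s)) (- expR (- w)).
  have dN : is_derive w 1 (fun s : R => - s) (-1) := is_deriveN (is_derive_id w 1).
  have := is_derive1_comp (f := expR) (g := fun s : R => - s) (x := w)
    (is_derive_expR (- w)) dN.
  by rewrite mulrN1.
have := is_deriveM d1 (is_deriveB (is_deriveZ (1 + t ^+ 2)^-1
  (is_deriveB (is_deriveZ t (is_derive_sinM t w)) (is_derive_cosM t w)))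
  (is_derive_cst (1 : R) w 1)).
move=> /is_derive_eq; apply; rewrite !fctE /= /GRing.scale /=.
have t2 : 1 + t ^+ 2 != 0 by rewrite lt0r_neq0// ltr_pwDl ?sqr_ge0.
by field.
Qed.

Let cvgF t : F t w @[w --> +oo] --> (0 : R).
Proof.
have e0 (M : R) : M * expR (- w) @[w --> +oo] --> (0 : R).
  by rewrite -(mulr0 M); apply: cvgMl_tmp; exact: cvgr_expR.
apply: (squeeze_cvgr (f := fun w => (- (`|t| + 2)) * expR (- w))
  (h := fun w => (`|t| + 2) * expR (- w))) => //.
apply: nearW => w; rewrite mulNr -ler_norml /F normrM gtr0_norm ?expR_gt0//.
rewrite mulrC ler_wpM2r ?expR_ge0//.
have t2 : 0 < 1 + t ^+ 2 by rewrite ltr_pwDl ?sqr_ge0.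
apply: (le_trans (ler_normB _ _)); rewrite normr1.
rewrite (_ : `|t| + 2 = `|t| + 1 + 1) ?lerD2r; last by rewrite -addrA.
rewrite normrM gtr0_norm ?invr_gt0//; apply: (@le_trans _ _ (`|t * sin (w * t) - cos (w * t)|)).
  by rewrite ler_piMl// invf_le1// lerDl sqr_ge0.
apply: (le_trans (ler_normB _ _)); rewrite normrM lerD ?cos_max//.
by rewrite ler_piMr// sin_max.
Qed.

Let integral_c t : (\int[lambda]_w (c t w)%:E = (2 * (1 + (1 + t ^+ 2)^-1))%:E)%E.
Proof.
rewrite ge0_symfun_integralT//; last first.
  by move=> w /=; rewrite /c /expNabs normrN mulNr cosN.
rewrite -set_itvcy EFinM; congr (_ * _)%E.
rewrite (@ge0_continuous_FTC2y _ (c t) (F t) 0 0)//.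
- rewrite /F oppr0 expR0 mul0r sin0 cos0 mulr0.
  by rewrite -EFinB; congr (_%:E); ring.
- exact: continuous_subspaceT.
- apply: cvg_at_right_filter; apply: differentiable_continuous.
  exact/derivable1_diffP/ex_derive.
- move=> x; rewrite in_itv/= andbT => x0.
  by rewrite derive1E (@derive_val _ _ _ _ _ _ _ (dF t x)) /c /expNabs gtr0_norm.
Qed.

Lemma measurable_expNabs : measurable_fun setT (expNabs : X -> R).
Proof. by apply: continuous_measurable_fun; exact: continuous_expNabs. Qed.

Let integral_expNabs : (\int[lambda]_w (expNabs w)%:E = 2%:E)%E.
Proof.
have := integral_c 0; rewrite expr0n addr0 invr1 /c.
under eq_integral do rewrite mulr0 cos0 mulrC EFinM.
rewrite ge0_integralZl//.
- move=> /(congr1 (fun y => (2^-1)%:E * y)%E); rewrite muleA -!EFinM.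
  by rewrite mulVf// mul1e mulrA mulVf// mul1r.
- by apply/measurable_EFinP; exact: measurable_expNabs.
- by move=> w _; rewrite lee_fin expNabs_ge0.
Qed.

Lemma integrable_expNabs : lambda.-integrable setT (EFin \o expNabs).
Proof.
apply/integrableP; split.
  by apply/measurable_EFinP; exact: measurable_expNabs.
rewrite (_ : integral _ _ _ = 2%:E) ?ltry// -integral_expNabs.
by apply: eq_integral => w _ /=; rewrite ger0_norm// expNabs_ge0.
Qed.

Let cintegrable_poisson t : cintegrable lambda setT (fun w => (expNabs w)%:C * expi (w * t)).
Proof.
apply: (cintegrable_le _ integrable_expNabs).
  apply: cmeasurableM; first by apply: cmeasurable_real; exact: measurable_expNabs.
  by apply: cmeasurable_expi; apply: measurable_funM.
by move=> w; rewrite normcM_expi normc_real ger0_norm// expNabs_ge0.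
Qed.

(** The real part is the integral of [c t] less that of [expNabs]. The imaginary part vanishes
    because w -> -w shows the integral equal to its own conjugate. *)
Lemma fourier_expNabs t :
  cintegral lambda setT (fun w => (expNabs w)%:C * expi (w * t)) =
  (2 * (1 + t ^+ 2)^-1)%:C.
Proof.
have ip := cintegrable_poisson t.
apply: complex_ext => /=.
  have mE := integrable_expNabs.
  have : \int[lambda]_w c t w = 2 * (1 + (1 + t ^+ 2)^-1).
    by rewrite /Rintegral integral_c.
  rewrite /c; under eq_Rintegral do rewrite mulrDr mulr1.
  rewrite RintegralD//; last first.
    have := ip.1; apply: eq_integrable => // w _ /=.
    by rewrite mul0r subr0.
  rewrite {1}/Rintegral integral_expNabs/= => E.
  rewrite [LHS](_ : _ = \int[lambda]_w (expNabs w * cos (w * t))).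
    by lra.
  by apply: eq_Rintegral => w _; rewrite mul0r subr0.
have : conjc (cintegral lambda setT (fun w => (expNabs w)%:C * expi (w * t))) =
    cintegral lambda setT (fun w => (expNabs w)%:C * expi (w * t)).
  have N1 : (-1 : R) != 0 by rewrite oppr_eq0 oner_neq0.
  rewrite -cintegral_conj// -[RHS]mul1r.
  rewrite [in X in _ = X * _](_ : 1 = (`|-1|^-1)%:C :> R[i]); last first.
    by rewrite normrN1 invr1.
  rewrite -(cintegral_affine 0 N1 ip); apply: eq_cintegral => w _.
  rewrite addr0 mulN1r /expNabs normrN mulNr -expi_conj.
  by rewrite conjcM conjc_real.
by move=> /(congr1 (@complex.Im R)); rewrite complexIm_conj /=; lra.
Qed.

Lemma fourier_expNabs_scale (eps t : R) : 0 < eps ->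
  cintegrable lambda setT (fun w => (expNabs (eps * w))%:C * expi (w * t)) /\
  cintegral lambda setT (fun w => (expNabs (eps * w))%:C * expi (w * t)) =
  (eps^-1 * (2 * (1 + (t / eps) ^+ 2)^-1))%:C.
Proof.
move=> e0; have eN0 := lt0r_neq0 e0; have ip := cintegrable_poisson (t / eps).
have E w : (expNabs (eps * w))%:C * expi (w * t) =
    (expNabs (eps * w + 0))%:C * expi ((eps * w + 0) * (t / eps)).
  by rewrite addr0; congr (_ * expi _); field.
have -> : (fun w => (expNabs (eps * w))%:C * expi (w * t)) =
    (fun w => (expNabs (eps * w + 0))%:C * expi ((eps * w + 0) * (t / eps))).
  by apply/funext => w; exact: E.
split; first exact: (cintegrable_affine _ eN0 ip).
by rewrite (cintegral_affine 0 eN0 ip) fourier_expNabs gtr0_norm// -rmorphM.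
Qed.

End poisson_kernel.

Section poisson_kernel_n.
Context {R : realType} (n : nat).
Local Notation X := (measurableTypeR R).

Definition expNabs_n (eps : R) (w : 'rV[R]_n) : R := \prod_i expNabs (eps * w 0 i).

(** A product of one-dimensional Poisson kernels, not the radial kernel. It is left unnormalised:
    its total mass (2 pi)^n is the constant of the inversion formula. *)
Definition poisson_n (z : 'rV[R]_n) : R := \prod_i (2 * (1 + z 0 i ^+ 2)^-1).

Lemma expi_dot (z w : 'rV[R]_n) : expi (dot w z) = \prod_i expi (w 0 i * z 0 i).
Proof.
rewrite /dot; elim/big_ind2 : _ => [|a b s t <- <-|//]; first exact: expi0.
by rewrite expiD.
Qed.

Lemma fourier_expNabs_n (eps : R) z : 0 < eps ->
  cintegrable (leb n) setT (fun t => (expNabs_n eps (vec t))%:C * expi (dot (vec t) z)) /\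
  cintegral (leb n) setT (fun t => (expNabs_n eps (vec t))%:C * expi (dot (vec t) z)) =
  (eps ^- n * poisson_n (eps^-1 *: z))%:C.
Proof.
move=> e0.
have [] := @leb_prod R n (fun i w => (expNabs (eps * w))%:C * expi (w * z 0 i)).
  by move=> i; have [] := fourier_expNabs_scale (z 0 i) e0.
have E : (fun t : n.-tuple X => \prod_i ((expNabs (eps * tnth t i))%:C * expi (tnth t i * z 0 i))) =
   (fun t => (expNabs_n eps (vec t))%:C * expi (dot (vec t) z)).
  apply/funext => t; rewrite big_split /= expi_dot /expNabs_n rmorph_prod.
  by congr (_ * _); apply: eq_bigr => i _; rewrite mxE.
rewrite E => ? ->; split => //.
under eq_bigr => i _.
  have [_ ->] := fourier_expNabs_scale (z 0 i) e0; over.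
rewrite -rmorph_prod; congr (_%:C); rewrite big_split /= prodr_const card_ord exprVn.
by congr (_ * _); apply: eq_bigr => i _; rewrite mxE [eps^-1 * _]mulrC.
Qed.

Lemma integral_poisson_n :
  (leb n).-integrable setT (fun t => (poisson_n (vec t))%:E) /\
  cintegral (leb n) setT (fun t => (poisson_n (vec t))%:C) = ((2 * pi) ^+ n)%:C.
Proof.
have i1 : (@lebesgue_measure R).-integrable setT (EFin \o (fun x : R => 2 * (1 + x ^+ 2)^-1)).
  have := integrableZl measurableT 2 (@integrable_oneDsqrV R).
  by apply: eq_integrable => // x _ /=; rewrite EFinM.
have [|ip Ep] := @leb_prod R n (fun i x => (2 * (1 + x ^+ 2)^-1)%:C).
  by move=> i; split => /=; [exact: i1|exact: integrable0].
have E : (fun t : n.-tuple X => \prod_i (2 * (1 + (tnth t i : R) ^+ 2)^-1)%:C) =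
   (fun t => (poisson_n (vec t))%:C).
  apply/funext => t; rewrite -rmorph_prod; congr (_%:C).
  by apply: eq_bigr => i _; rewrite mxE.
rewrite E in ip Ep; split; first exact: ip.1.
rewrite Ep; under eq_bigr => i _.
  rewrite (_ : cintegral _ _ _ = (2 * pi)%:C); last first.
    rewrite /cintegral /= RintegralZl//; last exact: integrable_oneDsqrV.
    rewrite /Rintegral integral_oneDsqrV /=.
    by under eq_integral do rewrite /=; rewrite integral0.
  over.
by rewrite prodr_const card_ord rmorphXn.
Qed.

End poisson_kernel_n.

Lemma cvg_prodr {R : realType} (I : Type) (r : seq I) (F : I -> nat -> R) (a : I -> R) :
  (forall i, F i k @[k --> \oo] --> a i) ->
  \prod_(i <- r) F i k @[k --> \oo] --> \prod_(i <- r) a i.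
Proof.
move=> Fa; elim: r => [|i r IHr].
  by rewrite big_nil; under eq_fun do rewrite big_nil; exact: cvg_cst.
by rewrite big_cons; under eq_fun do rewrite big_cons; apply: cvgM.
Qed.

Section fourier_inversion.
Context {R : realType} (n : nat).
Local Notation X := (measurableTypeR R).
Local Notation normc := (@Normc.normc R).
Variables (f : 'rV[R]_n -> R[i]) (f_S : schwartz f).

Lemma schwartz_cmeasurable0 : cmeasurable (fun t : n.-tuple X => f (vec t)).
Proof. by rewrite -(multi_partial0 f); exact: schwartz_cmeasurable. Qed.

Lemma schwartz_decay0 N : exists2 K : R, 0 <= K &
  forall x, normc (f x) <= K * decay N x.
Proof.
have := schwartz_decay f_S [ffun=> 0%N] N; by rewrite (multi_partial0 f).
Qed.

Lemma schwartz_cintegrable0 : cintegrable (leb n) setT (fun t => f (vec t)).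
Proof.
have [K _ fK] := schwartz_decay0 1.
exact: (cintegrable_decay_le schwartz_cmeasurable0 fK).
Qed.

Lemma schwartz_cmeasurable_fourierRn :
  cmeasurable (fun t : n.-tuple X => fourierRn f (vec t)).
Proof. exact: cmeasurable_fourierRn schwartz_cintegrable0. Qed.

Lemma expNabs_n_ge0 (eps : R) (w : 'rV[R]_n) : 0 <= expNabs_n eps w.
Proof. by apply: prodr_ge0 => i _; exact: expNabs_ge0. Qed.

Lemma expNabs_n_le1 (eps : R) (w : 'rV[R]_n) : expNabs_n eps w <= 1.
Proof. by apply: prodr_le1 => i; rewrite expNabs_ge0 expNabs_le1. Qed.

Lemma measurable_expNabs_n (eps : R) :
  measurable_fun setT (fun t : n.-tuple X => expNabs_n eps (vec t)).
Proof.
rewrite /expNabs_n; under eq_fun do under eq_bigr do rewrite mxE.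
apply: measurable_prod => i _.
apply: (measurableT_comp (@measurable_expNabs R)); apply: measurable_funM => //.
exact: measurable_coord.
Qed.

Lemma cvg_expNabs_n (w : 'rV[R]_n) : expNabs_n (harmonic k) w @[k --> \oo] --> (1 : R).
Proof.
rewrite (_ : 1 = \prod_(i < n) 1 :> R); last by rewrite big1_eq.
apply: cvg_prodr => i.
have -> : 1 = expNabs (0 * w 0 i) :> R by rewrite mul0r /expNabs normr0 oppr0 expR0.
apply: (@continuous_cvg _ R R _ _ (fun k => harmonic k * w 0 i) expNabs).
  exact: continuous_expNabs.
by apply: cvgMr_tmp; exact: cvg_harmonic.
Qed.

Lemma measurable_poisson_n : measurable_fun setT (fun t : n.-tuple X => poisson_n (vec t)).
Proof.
rewrite /poisson_n; under eq_fun do under eq_bigr do rewrite mxE.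
apply: measurable_prod => i _.
apply: measurable_funM => //.
by apply: (measurableT_comp (@measurable_oneDsqrV R)); exact: measurable_coord.
Qed.

Lemma poisson_n_ge0 (z : 'rV[R]_n) : 0 <= poisson_n z.
Proof. by apply: prodr_ge0 => i _; rewrite mulr_ge0// invr_ge0 addr_ge0 ?sqr_ge0. Qed.

Lemma poisson_n_le (z : 'rV[R]_n) : poisson_n z <= 2 ^+ n.
Proof.
rewrite (_ : 2 ^+ n = \prod_(i < n) 2); last by rewrite prodr_const card_ord.
apply: ler_prod => i _; rewrite mulr_ge0 ?invr_ge0 ?addr_ge0 ?sqr_ge0//=.
by rewrite ler_piMr// invf_le1 ?ltr_pwDl ?sqr_ge0// lerDl sqr_ge0.
Qed.

Lemma poisson_nN (z : 'rV[R]_n) : poisson_n (- z) = poisson_n z.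
Proof. by apply: eq_bigr => i _; rewrite mxE sqrrN. Qed.

Let mdot x : measurable_fun setT (fun t : n.-tuple X => dot (vec t) x).
Proof. exact: measurable_dot_vec. Qed.

Lemma cintegrable_fourierRn x :
  cintegrable (leb n) setT (fun t => fourierRn f (vec t) * expi (dot (vec t) x)).
Proof.
have [K _ fK] := fourierRn_decay f_S 1.
exact: (cintegrable_modulation (mdot x)
  (cintegrable_decay_le schwartz_cmeasurable_fourierRn fK)).
Qed.

(** The convergence factor makes f(y) e^(i w.(x - y)) integrable in (w, y) jointly. Fubini then
    turns the w-integral into eps^-n P((x - y) / eps), with P the kernel [poisson_n], and y = x +
    eps t removes the scaling. *)
Lemma poisson_regularization (eps : R) x : 0 < eps ->
  cintegral (leb n) setT (fun t => (expNabs_n eps (vec t))%:C *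
     (fourierRn f (vec t) * expi (dot (vec t) x))) =
  cintegral (leb n) setT (fun t => (poisson_n (vec t))%:C * f (x + eps *: vec t)).
Proof.
move=> e0.
have iE := (fourier_expNabs_n (0 : 'rV[R]_n) e0).1.
have iE' : (leb n).-integrable setT (fun t => (expNabs_n eps (vec t))%:E).
  have [+ _] := iE; apply: eq_integrable => // t _.
  by rewrite complexRe_M /= mul0r subr0 dotC /dot big1 ?cos0 ?mulr1// => i _; rewrite mxE mul0r.
have if0 := schwartz_cintegrable0.
pose g (p : n.-tuple X * n.-tuple X) : R[i] :=
  ((expNabs_n eps (vec p.1))%:C * f (vec p.2)) * expi (dot (vec p.1) (x - vec p.2)).
have mg : cmeasurable g.
  apply: cmeasurableM; first apply: cmeasurableM.
  - by apply: cmeasurable_real; exact: (measurableT_comp (measurable_expNabs_n eps)).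
  - exact: (cmeasurable_comp _ schwartz_cmeasurable0).
  - apply: cmeasurable_expi.
    rewrite (_ : (fun _ => _) = (fun p : n.-tuple X * n.-tuple X =>
      dot (vec p.1) x - dot (vec p.1) (vec p.2))).
      by apply: measurable_funB; [exact: (measurableT_comp (mdot x))|exact: measurable_dot2].
    by apply/funext => p; rewrite dotBr.
have ig : cintegrable (leb n \x leb n)%E setT g.
  apply: (cintegrable_prodM_le mg iE' (cintegrable_normc if0)) => s t.
  by rewrite normcM_expi Normc.normcM normc_real ger0_norm ?expNabs_n_ge0.
transitivity (cintegral (leb n \x leb n)%E setT g).
  rewrite -cintegral12//; apply: eq_cintegral => s _; rewrite /g /=.
  rewrite /fourierRn /integralRn.
  have is_ : cintegrable (leb n) setT (fun t => f (vec t) * expi (- dot (vec t) (vec s))).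
    apply: cintegrable_modulation => //; apply: measurableT_comp => //; exact: mdot.
  rewrite -cintegralZr// -cintegralZ; last first.
    by under eq_fun do rewrite mulrC; exact: cintegrableZ.
  apply: eq_cintegral => t _; rewrite -!mulrA -expiD; congr (_ * (_ * expi _)).
  by rewrite dotBr [dot (vec t) _]dotC addrC.
rewrite -cintegral21//.
transitivity (cintegral (leb n) setT (fun t =>
    f (vec t) * (eps ^- n * poisson_n (eps^-1 *: (x - vec t)))%:C)).
  apply: eq_cintegral => t _.
  have [iz <-] := fourier_expNabs_n (x - vec t) e0.
  by rewrite -cintegralZ//; apply: eq_cintegral => s _; rewrite /g /= mulrCA mulrA.
pose h (t : n.-tuple X) := (poisson_n (eps^-1 *: (x - vec t)))%:C * f (vec t).
have E t : (poisson_n (vec t))%:C * f (x + eps *: vec t) = h (taffine eps (x 0) t).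
  rewrite /h vec_taffine opprD addrCA subrr addr0 scalerN scalerA mulVf ?lt0r_neq0//.
  by rewrite scale1r poisson_nN [x + _]addrC.
have ih : cintegrable (leb n) setT h.
  apply: (cintegrableM_bounded (K := 2 ^+ n)) => //.
    apply: cmeasurable_real.
    have := measurableT_comp measurable_poisson_n
      (measurable_taffine (- eps^-1) ((eps^-1 *: x) 0)).
    congr measurable_fun; apply/funext => t /=.
    by rewrite vec_taffine scalerBr addrC scaleNr.
  by move=> t; rewrite normc_real ger0_norm ?poisson_n_ge0 ?poisson_n_le.
under [RHS]eq_cintegral do rewrite E.
rewrite (cintegral_taffine (x 0) (lt0r_neq0 e0) ih) -cintegralZ//.
apply: eq_cintegral => t _; rewrite /h gtr0_norm// exprVn mulrC rmorphM.
by rewrite -mulrA.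
Qed.

(** Both sides of [poisson_regularization] pass to the limit eps -> 0: the left one is dominated by
    the modulus of the transform, the right one by a multiple of the kernel, with [f] bounded and
    continuous at x. *)
Theorem fourierRn_inversion x :
  integralRn (fun w => fourierRn f w * expi (dot w x)) = ((2 * pi) ^+ n)%:C * f x.
Proof.
have [K _ fK] := schwartz_decay0 1.
have [K' _ ffK] := fourierRn_decay f_S 1.
have if0 := schwartz_cintegrable0.
pose h k : R := harmonic k.
have h0 k : 0 < h k by exact: harmonic_gt0.
have mf := schwartz_cmeasurable0.
have [||||t|t|lRe lIm] := @cdominated_convergence R _ _ (leb n)
  (fun k t => (expNabs_n (h k) (vec t))%:C *
     (fourierRn f (vec t) * expi (dot (vec t) x)))
  (fun t => fourierRn f (vec t) * expi (dot (vec t) x))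
  (fun t => normc (fourierRn f (vec t) * expi (dot (vec t) x))).
- move=> k; apply: cmeasurableM.
    by apply: cmeasurable_real; exact: measurable_expNabs_n.
  exact: (cintegrable_measurable (cintegrable_fourierRn x)).
- exact: (cintegrable_measurable (cintegrable_fourierRn x)).
- exact: (cintegrable_normc (cintegrable_fourierRn x)).
- move=> k t; rewrite [leLHS]Normc.normcM normc_real ger0_norm ?expNabs_n_ge0//.
  by rewrite ler_piMl ?normc_ge0// expNabs_n_le1.
- under eq_fun do rewrite complexReZ.
  have := cvgMr_tmp (b := complex.Re (fourierRn f (vec t) * expi (dot (vec t) x)))
    (cvg_expNabs_n (vec t)).
  by rewrite mul1r; apply.
- under eq_fun do rewrite complexImZ.
  have := cvgMr_tmp (b := complex.Im (fourierRn f (vec t) * expi (dot (vec t) x)))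
    (cvg_expNabs_n (vec t)).
  by rewrite mul1r; apply.
have cvgxh v : x + h k *: v @[k --> \oo] --> x.
  have hv : h k *: v @[k --> \oo] --> 0 *: v.
    by apply: cvgZr_tmp; exact: cvg_harmonic.
  by have := cvgD (cvg_cst x) hv; rewrite scale0r addr0; apply.
have Kx y : normc (f y) <= K.
  apply: (le_trans (fK y)); rewrite ler_piMr ?decay_le1//.
  by rewrite -(pmulr_lge0 _ (decay_gt0 1 y)) (le_trans _ (fK y))// normc_ge0.
have [||||t|t|rRe rIm] := @cdominated_convergence R _ _ (leb n)
  (fun k t => (poisson_n (vec t))%:C * f (x + h k *: vec t))
  (fun t => (poisson_n (vec t))%:C * f x)
  (fun t => poisson_n (vec t) * K).
- move=> k; apply: cmeasurableM.
    by apply: cmeasurable_real; exact: measurable_poisson_n.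
  have := cintegrable_measurable (cintegrable_taffine (x 0) (lt0r_neq0 (h0 k)) if0).
  by under eq_fun do rewrite vec_taffine addrC.
- apply: cmeasurableM; last exact: cmeasurable_cst.
  by apply: cmeasurable_real; exact: measurable_poisson_n.
- have := integrableZr measurableT K (@integral_poisson_n R n).1.
  by apply: eq_integrable => // t _ /=; rewrite EFinM.
- move=> k t; rewrite Normc.normcM normc_real ger0_norm ?poisson_n_ge0//.
  by rewrite ler_wpM2l ?poisson_n_ge0.
- rewrite complexReZ; under eq_fun do rewrite complexReZ.
  apply: cvgMl_tmp.
  apply: (@continuous_cvg _ 'rV[R]_n R _ _ (fun k => x + h k *: vec t)
    (fun y => complex.Re (f y))); last exact: cvgxh.
  apply: differentiable_continuous.
  by have := (schwartz_differentiable f_S [ffun=> 0%N] x).1; rewrite multi_partial0.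
- rewrite complexImZ; under eq_fun do rewrite complexImZ.
  apply: cvgMl_tmp.
  apply: (@continuous_cvg _ 'rV[R]_n R _ _ (fun k => x + h k *: vec t)
    (fun y => complex.Im (f y))); last exact: cvgxh.
  apply: differentiable_continuous.
  by have := (schwartz_differentiable f_S [ffun=> 0%N] x).2; rewrite multi_partial0.
have Er : integralRn (fun w => fourierRn f w * expi (dot w x)) =
    cintegral (leb n) setT (fun t => (poisson_n (vec t))%:C * f x).
  apply: complex_ext.
    rewrite -(cvg_lim _ lRe)//; apply: cvg_lim => //.
    by under eq_fun do rewrite poisson_regularization//.
  rewrite -(cvg_lim _ lIm)//; apply: cvg_lim => //.
  by under eq_fun do rewrite poisson_regularization//.
rewrite Er cintegralZr; last first.
  by split; [exact: (@integral_poisson_n R n).1|exact: integrable0].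
by rewrite (@integral_poisson_n R n).2.
Qed.

End fourier_inversion.

(** * Polar coordinates *)

Section power_tail.
Context {R : realType}.
Local Notation lambda := (@lebesgue_measure R).
Local Notation X := (measurableTypeR R).
Variables (n : nat) (rho : R).
Hypotheses (n_gt0 : (0 < n)%N) (rho_gt0 : 0 < rho).

Let f (s : R) : R := s^-1 ^+ n.+1.

Let dF (s : R) : 0 < s -> is_derive s 1 (fun s => - n%:R^-1 * s^-1 ^+ n) (f s).
Proof.
move=> s0; have sN0 := lt0r_neq0 s0.
have dV : is_derive s (1 : R) (fun s : R => s^-1) (- s ^- 2 *: 1).
  exact: is_deriveV.
have E : (fun s : R => - n%:R^-1 * s^-1 ^+ n) =
    - n%:R^-1 \*: ((fun s : R => s^-1) ^+ n) :> (R -> R).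
  by apply/funext => r; rewrite !fctE.
rewrite E; apply: is_derive_eq (is_deriveZ (- n%:R^-1) (is_deriveX n dV)) _.
rewrite /f /GRing.scale /=.
have nN0 : n%:R != 0 :> R by rewrite pnatr_eq0 -lt0n.
have -> : s^-1 ^+ n.+1 = s^-1 ^+ n.-1 * s ^- 2.
  by rewrite -exprVn -exprD addn2 prednK.
rewrite mulr1; move: (s^-1 ^+ n.-1) => y.
by field; rewrite sN0 nN0.
Qed.

Let tail_right : (\int[lambda]_(s in `[rho, +oo[) (f s)%:E = (n%:R^-1 * rho^-1 ^+ n)%:E)%E.
Proof.
rewrite (@ge0_continuous_FTC2y _ f (fun s => - n%:R^-1 * s^-1 ^+ n) rho 0).
- by rewrite -EFinB; congr (_%:E); ring.
- by move=> s rs; rewrite exprn_ge0// invr_ge0 ltW// (lt_le_trans rho_gt0).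
- apply: continuous_in_subspaceT => s; rewrite inE/= in_itv/= andbT => rs.
  apply: (@continuous_comp _ _ _ (fun s : R => s^-1) (fun s => s ^+ n.+1)).
    by apply: inv_continuous; rewrite lt0r_neq0// (lt_le_trans rho_gt0).
  exact: exprn_continuous.
- have V0 : s^-1 @[s --> +oo] --> (0 : R).
    apply/gtr0_cvgV0; last exact: cvg_id.
    exact: nbhs_pinfty_gt.
  have Vn : s^-1 ^+ n @[s --> +oo] --> (0 : R).
    have := @continuous_cvg _ R R _ _ _ (fun s => s ^+ n) 0 (@exprn_continuous R n 0) V0.
    by rewrite expr0n eqn0Ngt n_gt0; apply.
  have : - n%:R^-1 * s^-1 ^+ n @[s --> +oo] --> - n%:R^-1 * (0 : R).
    exact: cvgMl_tmp.
  by rewrite mulr0.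
- by move=> s rs; have := dF (lt_trans rho_gt0 rs) => ?; exact: ex_derive.
- have /derivable1_diffP/differentiable_continuous cF :=
    @ex_derive _ _ _ _ _ _ _ (dF rho_gt0).
  by apply: cvg_at_right_filter; exact: cF.
- move=> s; rewrite in_itv/= andbT => rs.
  by rewrite derive1E (@derive_val _ _ _ _ _ _ _ (dF (lt_trans rho_gt0 rs))).
Qed.

(** The radial integral left over in polar coordinates. The even integrand is g(s) + g(-s) with g
    supported on s >= rho > 0, so the two halves do not overlap. *)
Lemma integral_power_tail :
  (\int[lambda]_s (if (rho <= `|s|)%R then `|s|^-1 ^+ n.+1 else 0)%:E =
   (2 * n%:R^-1 * rho^-1 ^+ n)%:E)%E.
Proof.
pose g (s : R) : R := if rho <= s then f s else 0.
have g0 s : 0 <= g s.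
  rewrite /g; case: ifPn => // rs.
  by rewrite exprn_ge0// invr_ge0 ltW// (lt_le_trans rho_gt0).
have mg : measurable_fun setT (g : X -> R).
  apply: measurable_fun_ifT => //; first exact: measurable_fun_ler.
  by apply: measurable_funX; exact: measurable_inv.
have ig : (\int[lambda]_s (g s)%:E = (n%:R^-1 * rho^-1 ^+ n)%:E)%E.
  rewrite -tail_right [RHS]integral_mkcond; apply: eq_integral => s _.
  by rewrite patchE /g mem_setE in_itv/= andbT; case: ifP.
rewrite (eq_integral (fun s : X => (g s)%:E + (g (-1 * s + 0))%:E)%E); last first.
  move=> s _; rewrite /g mulN1r addr0 -EFinD; congr (_%:E).
  have [s0|s0] := leP 0 s.
    rewrite ger0_norm// [X in _ + X]ifF ?addr0//; apply/negbTE; rewrite -ltNge.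
    by rewrite (le_lt_trans _ rho_gt0)// oppr_le0.
  rewrite ltr0_norm// [X in X + _]ifF ?add0r//; apply/negbTE; rewrite -ltNge.
  by rewrite (lt_trans s0).
have mgE : measurable_fun setT (EFin \o g : X -> \bar R) by apply/measurable_EFinP.
rewrite ge0_integralD//; last 2 first.
- by move=> s _; rewrite lee_fin.
- exact: (measurableT_comp mgE (measurable_affine (-1) 0)).
rewrite (@ge0_integral_affine _ (-1) 0 (EFin \o g))//.
- by rewrite normrN1 invr1 mul1e ig -EFinD; congr (_%:E); ring.
- by move=> s; rewrite lee_fin.
Qed.

End power_tail.
Section polar_coordinates.
Context {R : realType} (n : nat).
Hypothesis n_gt1 : (1 < n)%N.
Local Notation X := (measurableTypeR R).
Local Notation lambda := (@lebesgue_measure R).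
Local Notation V := (n.-tuple X).
Local Notation e := (fun t : V => enorm (vec t)).

Let n_gt0 : (0 < n)%N. Proof. exact: ltnW. Qed.

Definition tscale (s : R) (t : V) : V := taffine s (fun=> 0) t.

Lemma vec_tscale s t : vec (tscale s t) = s *: vec t.
Proof. by apply/rowP => i; rewrite !mxE tnth_mktuple addr0. Qed.

Lemma tscaleA s r t : tscale s (tscale r t) = tscale (s * r) t.
Proof. by apply: eq_from_tnth => i; rewrite !tnth_mktuple !addr0 mulrA. Qed.

Lemma normalizeE (t : V) : normalize t = tscale (e t)^-1 t.
Proof. by apply: eq_from_tnth => i; rewrite !tnth_mktuple addr0 mulrC. Qed.

Lemma enorm_ge0 (x : 'rV[R]_n) : 0 <= enorm x.
Proof. exact: sqrtr_ge0. Qed.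

Lemma enormZ s (x : 'rV[R]_n) : enorm (s *: x) = `|s| * enorm x.
Proof.
rewrite /enorm dotZl dotC dotZl mulrA -expr2 sqrtrM ?sqr_ge0//.
by rewrite sqrtr_sqr.
Qed.

Lemma enorm_eq0 (x : 'rV[R]_n) : enorm x = 0 -> x = 0.
Proof.
have d0 i : 0 <= x 0 i * x 0 i by rewrite -expr2 sqr_ge0.
move=> /eqP; rewrite /enorm sqrtr_eq0 => dle; apply/rowP => i; rewrite mxE.
have : dot x x == 0 by rewrite eq_le dle sumr_ge0.
rewrite psumr_eq0// => /allP /(_ i (mem_index_enum _)) /=.
by rewrite mulf_eq0 orbb => /eqP.
Qed.

Lemma measurable_tscale d (T : measurableType d) (r : T -> R) (g : T -> V) :
  measurable_fun setT r -> measurable_fun setT g ->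
  measurable_fun setT (fun x => tscale (r x) (g x)).
Proof.
move=> mr mg; apply/measurable_fun_tnthP => i.
rewrite (_ : _ \o _ = fun x => r x * (tnth (g x) i : R)).
  apply: measurable_funM => //.
  exact: (measurableT_comp (@measurable_coord R n i)).
by apply/funext => x /=; rewrite tnth_mktuple addr0.
Qed.

(** A sphere integral becomes an integral over the punctured ball of the extension that is constant
    on rays; the complement of the ball is null for the restricted measure. *)
Lemma ge0_integral_sphere (G : V -> \bar R) :
  measurable_fun setT G -> (forall u, 0 <= G u)%E ->
  (\int[sphere_measure]_u G u =
   n%:R%:E * \int[leb n]_t (if (0 < e t <= 1)%R then G (normalize t) else 0))%E.
Proof.
move=> mG G0; rewrite /sphere_measure ge0_integral_mscale//; congr (_ * _)%E.
rewrite (ge0_integral_pushforward (@measurable_normalize R n))//.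
rewrite preimage_setT.
have mB := @measurable_punctured_ball R n.
have mGn : measurable_fun setT (G \o @normalize R n).
  exact: (measurableT_comp mG (@measurable_normalize R n)).
rewrite (@ge0_negligible_integral _ _ _ _ _ (~` punctured_ball))//; last 3 first.
- exact: measurableC.
- by move=> t _; exact: G0.
- by rewrite /= /mrestr setICl measure0.
rewrite setTD setCK (eq_measure_integral (leb n)); last first.
  by move=> A mA /setIidPl AB; rewrite /= /mrestr AB.
rewrite integral_mkcond; apply: eq_integral => t _.
by rewrite patchE mem_setE.
Qed.

(** The origin lies in the hyperplane where the first coordinate is 0, which is null as a product
    with the factor {0}. *)
Lemma leb_enorm_gt0 : {ae leb n, forall t : V, 0 < e t}.
Proof.
pose N : set V := [set t | tnth t (Ordinal n_gt0) = 0 :> R].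
exists N; split.
- rewrite (_ : N = (fun t : V => tnth t (Ordinal n_gt0) : R) @^-1` [set 0])//.
  by rewrite -[X in measurable X]setTI; exact: (measurable_coord (Ordinal n_gt0)).
- rewrite /N; move: (n_gt0); case: (n) => // m m0.
  have -> : Ordinal m0 = ord0 by apply: val_inj.
  rewrite /= /leb_step /pushforward.
  rewrite (_ : _ @^-1` _ = [set (0 : X)] `*` [set: m.-tuple X]); last first.
    by apply/seteqP; split => -[x t] /=; rewrite tnth0 => // -[].
  have l0 : (lambda [set 0%R] * leb m setT = 0)%E.
    by rewrite lebesgue_measure_set1 mul0e.
  by rewrite -l0; exact: product_measure1E.
- move=> t /= /negP; rewrite -leNgt => e0.
  have : enorm (vec t) = 0 by apply/eqP; rewrite eq_le e0 enorm_ge0.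
  by move=> /enorm_eq0 /rowP /(_ (Ordinal n_gt0)); rewrite !mxE.
Qed.

(** At s = 1 this is the indicator of the punctured ball. The substitution y = s t carries that ball
    to 0 < |y| <= |s|, hence the parameter. *)
Let chi (s : R) (t : V) : R := if (0 < e t) && (e t <= `|s|) then 1 else 0.

Let chi_ge0 s t : 0 <= chi s t. Proof. by rewrite /chi; case: ifP. Qed.

Let measurable_chi d (T : measurableType d) (r : T -> R) (g : T -> V) :
  measurable_fun setT r -> measurable_fun setT g ->
  measurable_fun setT (fun x => chi (r x) (g x)).
Proof.
move=> mr mg; have me := measurableT_comp (@measurable_enorm_vec R n) mg.
apply: measurable_fun_ifT => //; apply: measurable_and.
  exact: measurable_fun_ltr.
by apply: measurable_fun_ler => //; exact: measurableT_comp.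
Qed.

Variable F : V -> \bar R.
Hypothesis mF : measurable_fun setT F.
Hypothesis F_ge0 : forall t, (0 <= F t)%E.

Let ray (u : V) := (\int[lambda]_s ((`|s| ^+ n.-1)%:E * F (tscale s u)))%E.

Let measurable_ray_integrand :
  measurable_fun setT (fun p : V * X => (`|p.2| ^+ n.-1)%:E * F (tscale p.2 p.1))%E.
Proof.
apply: emeasurable_funM.
  apply/measurable_EFinP; apply: measurable_funX; exact: measurableT_comp.
apply: (measurableT_comp mF); exact: measurable_tscale.
Qed.

Let measurable_ray : measurable_fun setT ray.
Proof.
apply: (measurable_fun_fubini_tonelli_F
  (fun p : V * X => (`|p.2| ^+ n.-1)%:E * F (tscale p.2 p.1))%E) => //.
by move=> p; rewrite mule_ge0// lee_fin exprn_ge0.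
Qed.

Let ray_ge0 u : (0 <= ray u)%E.
Proof. by apply: integral_ge0 => s _; rewrite mule_ge0// lee_fin exprn_ge0. Qed.

(* The substitution [s -> |t| s] trades the unit vector [t / |t|] for [t]. *)
Let ray_normalize t : 0 < e t -> ray (normalize t) =
  (\int[lambda]_s ((e t ^+ n * `|s| ^+ n.-1)%:E * F (tscale s t)))%E.
Proof.
move=> e0; have eN0 := lt0r_neq0 e0.
pose g s := ((`|s| ^+ n.-1)%:E * F (tscale s (normalize t)))%E.
have mg : measurable_fun setT (g : X -> \bar R).
  apply: emeasurable_funM.
    by apply/measurable_EFinP; apply: measurable_funX.
  apply: (measurableT_comp mF).
  by apply: (@measurable_tscale _ X id (fun=> normalize t)).
have g0 s : (0 <= g s)%E by rewrite mule_ge0// lee_fin exprn_ge0.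
have := ge0_integral_affine 0 eN0 mg g0.
move=> /(congr1 (fun z => (e t)%:E * z)%E).
rewrite muleA -EFinM gtr0_norm// mulfV// mul1e /ray -/g => <-.
rewrite -ge0_integralZl//; last 2 first.
- exact: (measurableT_comp mg (measurable_affine (e t) 0)).
- by rewrite lee_fin ltW.
apply: eq_integral => s _; rewrite /g addr0 normalizeE tscaleA mulrAC mulfV// mul1r.
rewrite muleA -EFinM; congr (_%:E * _)%E.
by rewrite normrM gtr0_norm// exprMn mulrA -exprS prednK.
Qed.

(** [P] is the integrand in (t, s), with t in the ball; [Q] is what it becomes in (s, y) for y = s
    t, the Jacobian included: |t|^n |s|^(n-1) |s|^-n = |y|^n |s|^(-n-1). *)
Let P (p : V * X) : \bar R :=
  ((chi 1 p.1 * e p.1 ^+ n * `|p.2| ^+ n.-1)%:E * F (tscale p.2 p.1))%E.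

Let Q (p : X * V) : \bar R :=
  ((chi p.1 p.2 * e p.2 ^+ n * `|p.1|^-1 ^+ n.+1)%:E * F p.2)%E.

(* The substitution [y = s t], for fixed [s]. *)
Let integral_PQ s : (\int[leb n]_t P (t, s) = \int[leb n]_t Q (s, t))%E.
Proof.
(* At s = 0 there is no substitution, but both sides vanish: [P] because n - 1 > 0, [Q] because the
   inverse of 0 is 0. *)
have [->|s0] := eqVneq s 0.
  rewrite !integral0_eq// => t _; rewrite /P /Q /=.
    by rewrite normr0 invr0 expr0n mulr0 mul0e.
  rewrite normr0 expr0n (_ : (n.-1 == 0)%N = false) ?mulr0 ?mul0e//.
  by case: (n) n_gt1 => [|[]].
pose h t := ((chi s t * (`|s|^-1 * e t) ^+ n * `|s| ^+ n.-1)%:E * F t)%E.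
have ns0 : 0 < `|s| by rewrite normr_gt0.
have mh : measurable_fun setT h.
  apply: emeasurable_funM => //; apply/measurable_EFinP.
  apply: measurable_funM => //; apply: measurable_funM; first exact: measurable_chi.
  apply: measurable_funX; apply: measurable_funM => //.
  exact: measurable_enorm_vec.
have h0 t : (0 <= h t)%E.
  rewrite mule_ge0// lee_fin mulr_ge0 ?exprn_ge0// mulr_ge0//.
  by rewrite exprn_ge0// mulr_ge0 ?invr_ge0// enorm_ge0.
have := ge0_integral_taffine (fun=> 0) s0 mh h0.
have E t : h (taffine s (fun=> 0) t) = P (t, s).
  rewrite -/(tscale s t) /h /P /=; congr (_%:E * _)%E.
  rewrite vec_tscale enormZ mulKf ?normr_eq0//; congr (_ * _ * _).
  rewrite /chi vec_tscale enormZ pmulr_rgt0// normr1.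
  by rewrite -{2}(mulr1 `|s|) ler_pM2l.
under eq_integral do rewrite E; move=> ->.
rewrite -ge0_integralZl//.
  apply: eq_integral => t _; rewrite /h /Q /= muleA -EFinM; congr (_%:E * _)%E.
  have sN0 := lt0r_neq0 ns0.
  have -> : `|s|^-1 ^+ n.+1 = `|s|^-1 ^+ n * `|s|^-1 ^+ n * `|s| ^+ n.-1.
    rewrite exprSr -mulrA; congr (_ * _).
    rewrite -{1}(prednK n_gt0) exprSr mulrAC -exprMn mulVf// expr1n mul1r//.
  by rewrite exprMn; ring.
Qed.

(* With [r = |t|], Tonelli and [dy = |s|^n dt] give
     n int_{|t| <= 1} r^n int |s|^(n-1) F(s t) ds dt
       = int |y|^n F(y) (n int_{|s| >= |y|} |s|^(-n-1) ds) dy = 2 int F. *)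
Lemma polar_ge0 : (\int[sphere_measure]_u ray u = 2%:E * \int[leb n]_t F t)%E.
Proof.
have P0 p : (0 <= P p)%E.
  by rewrite mule_ge0// lee_fin !mulr_ge0 ?exprn_ge0// enorm_ge0.
have mP : measurable_fun setT P.
  apply: emeasurable_funM.
    apply/measurable_EFinP; apply: measurable_funM; first apply: measurable_funM.
    - exact: measurable_chi.
    - by apply: measurable_funX; exact: (measurableT_comp (@measurable_enorm_vec R n)).
    - by apply: measurable_funX; exact: measurableT_comp.
  by apply: (measurableT_comp mF); exact: measurable_tscale.
have Q0 p : (0 <= Q p)%E.
  by rewrite mule_ge0// lee_fin !mulr_ge0 ?exprn_ge0 ?invr_ge0// enorm_ge0.
have mQ : measurable_fun setT Q.
  apply: emeasurable_funM; last exact: measurableT_comp.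
  apply/measurable_EFinP; apply: measurable_funM; first apply: measurable_funM.
  - exact: measurable_chi.
  - by apply: measurable_funX; exact: (measurableT_comp (@measurable_enorm_vec R n)).
  - apply: measurable_funX; apply: (measurableT_comp (@measurable_inv R)).
    exact: measurableT_comp.
rewrite ge0_integral_sphere//.
transitivity (n%:R%:E * \int[leb n]_t \int[lambda]_s P (t, s))%E.
  congr (_ * _)%E; apply: eq_integral => t _; case: ifPn => [/andP[et0 et1]|et].
    rewrite ray_normalize//; apply: eq_integral => s _.
    by rewrite /P /chi /= et0 normr1 et1 mul1r.
  rewrite integral0_eq// => s _; rewrite /P /chi /= normr1.
  by rewrite (negbTE et) !mul0r mul0e.
rewrite (fubini_tonelli P)//.
under [X in (_ * X)%E]eq_integral do rewrite integral_PQ.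
rewrite (fubini_tonelli Q)//.
rewrite -ge0_integralZl//; last 2 first.
- exact: (measurable_fun_fubini_tonelli_G Q).
- by move=> t _; exact: integral_ge0.
rewrite -ge0_integralZl//.
(* Equality may fail at the origin, where [chi] vanishes and [F] need not; this is a null set. *)
apply: ge0_ae_eq_integral => //.
- apply: emeasurable_funM => //; exact: (measurable_fun_fubini_tonelli_G Q).
- by apply: emeasurable_funM.
- by move=> t _; rewrite mule_ge0// integral_ge0.
- by move=> t _; rewrite mule_ge0.
apply: filterS leb_enorm_gt0 => t et0 _.
transitivity (n%:R%:E * \int[lambda]_s ((e t ^+ n)%:E * F t *
    (if (e t <= `|s|)%R then `|s|^-1 ^+ n.+1 else 0)%:E))%E.
  congr (_ * _)%E; apply: eq_integral => s _; rewrite /Q /chi /= et0 /=.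
  by case: ifP => _; rewrite ?(mul0r, mul0e, mule0)// mul1r muleAC -EFinM.
rewrite ge0_integralZl//; last 3 first.
- apply/measurable_EFinP; apply: measurable_fun_ifT => //.
    exact: measurable_fun_ler.
  by apply: measurable_funX; apply: (measurableT_comp (@measurable_inv R)).
- by move=> s _; case: ifP => // _; rewrite lee_fin exprn_ge0// invr_ge0.
- by rewrite mule_ge0// lee_fin exprn_ge0// enorm_ge0.
rewrite integral_power_tail// muleAC muleA -!EFinM; congr (_%:E * _)%E.
have nN0 : n%:R != 0 :> R by rewrite pnatr_eq0 -lt0n.
rewrite exprVn; have := expf_neq0 n (lt0r_neq0 et0); move: (e t ^+ n) => y y0.
by field; rewrite nN0 y0.
Qed.

End polar_coordinates.

(** * Polar coordinates for integrable functions *)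

Section complex_polar.
Context {R : realType} (n : nat).
Hypothesis n_gt1 : (1 < n)%N.
Local Notation X := (measurableTypeR R).
Local Notation lambda := (@lebesgue_measure R).
Local Notation V := (n.-tuple X).
Local Notation sigma := (@sphere_measure R n).

Let fpos (f : V -> R) (t : V) : \bar R := (EFin \o f)^\+%E t.
Let fneg (f : V -> R) (t : V) : \bar R := (EFin \o f)^\-%E t.

Let ray (F : V -> \bar R) (u : V) : \bar R :=
  (\int[lambda]_s ((`|s| ^+ n.-1)%:E * F (tscale s u)))%E.

Let measurable_ray F : measurable_fun setT F -> (forall t, 0 <= F t)%E ->
  measurable_fun setT (ray F).
Proof.
move=> mF F0.
apply: (measurable_fun_fubini_tonelli_F
  (fun p : V * X => (`|p.2| ^+ n.-1)%:E * F (tscale p.2 p.1))%E) => //.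
- apply: emeasurable_funM.
    by apply/measurable_EFinP; apply: measurable_funX; exact: measurableT_comp.
  by apply: (measurableT_comp mF); exact: measurable_tscale.
- by move=> p; rewrite mule_ge0// lee_fin exprn_ge0.
Qed.

Let integrable_ray F : (leb n).-integrable setT F -> (forall t, 0 <= F t)%E ->
  sigma.-integrable setT (ray F).
Proof.
move=> /integrableP[mF Foo] F0; apply/integrableP; split; first exact: measurable_ray.
have ray0 u : (0 <= ray F u)%E.
  by apply: integral_ge0 => s _; rewrite mule_ge0// lee_fin exprn_ge0.
under eq_integral do rewrite gee0_abs//.
rewrite (polar_ge0 n_gt1 mF F0) lte_mul_pinfty//.
by move: Foo; under eq_integral do rewrite gee0_abs//.
Qed.

(** The ray integrals of the positive and negative parts are integrable over the sphere, hence
    finite almost everywhere, and there their difference is the ray integral of [f]. *)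
Lemma polar_integrable (f : V -> R) : (leb n).-integrable setT (EFin \o f) ->
  sigma.-integrable setT
    (fun u => (\int[lambda]_s (`|s| ^+ n.-1 * f (tscale s u)))%:E) /\
  \int[sigma]_u \int[lambda]_s (`|s| ^+ n.-1 * f (tscale s u)) =
  2 * \int[leb n]_t f t.
Proof.
move=> intf; have mf := measurable_int _ intf.
have ip : (leb n).-integrable setT (fpos f) by exact: integrable_funepos.
have iq : (leb n).-integrable setT (fneg f) by exact: integrable_funeneg.
have p0 t : (0 <= fpos f t)%E by exact: funepos_ge0.
have q0 t : (0 <= fneg f t)%E by exact: funeneg_ge0.
have irp := integrable_ray ip p0; have irq := integrable_ray iq q0.
have E u : (\int[lambda]_s (`|s| ^+ n.-1 * f (tscale s u)) =
    fine (ray (fpos f) u - ray (fneg f) u)).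
  rewrite /Rintegral integralE; congr (fine (_ - _)); apply: eq_integral => s _.
    rewrite /fpos !funeposE /= -!EFin_max -EFinM maxr_pMr ?exprn_ge0//.
    by rewrite mulr0.
  rewrite /fneg !funenegE /= -!EFin_max -EFinM maxr_pMr ?exprn_ge0//.
  by rewrite mulr0 mulrN.
have ae : ae_eq sigma setT
    (fun u => (\int[lambda]_s (`|s| ^+ n.-1 * f (tscale s u)))%:E)
    (fun u => ray (fpos f) u - ray (fneg f) u)%E.
  have := integrable_ae measurableT (integrableB measurableT irp irq).
  by apply: filterS => u /(_ I) fu _; rewrite E fineK.
have mE : measurable_fun setT
    (fun u : V => (\int[lambda]_s (`|s| ^+ n.-1 * f (tscale s u)))%:E).
  apply/measurable_EFinP; under eq_fun do rewrite E.
  apply: (measurableT_comp (fine_measurable measurableT)).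
  by apply: emeasurable_funB; [exact: measurable_int irp|exact: measurable_int irq].
split; first exact: (ae_eq_integrable mE ae (integrableB measurableT irp irq)).
transitivity (fine (\int[sigma]_u (ray (fpos f) u - ray (fneg f) u))%E).
  congr fine; apply: ae_eq_integral => //.
  by apply: emeasurable_funB; [exact: measurable_int irp|exact: measurable_int irq].
rewrite integralB//.
rewrite (polar_ge0 n_gt1 (measurable_int _ ip) p0).
rewrite (polar_ge0 n_gt1 (measurable_int _ iq) q0).
rewrite -muleBr//; last first.
  by apply: fin_num_adde_defr; apply: integrable_fin_num.
rewrite /Rintegral [in RHS]integralE fineM//.
by rewrite fin_numB; apply/andP; split; exact: integrable_fin_num.
Qed.

Lemma cpolar (f : V -> R[i]) : cintegrable (leb n) setT f ->
  cintegrable sigma setT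
    (fun u => cintegral lambda setT (fun s => (`|s| ^+ n.-1)%:C * f (tscale s u))) /\
  cintegral sigma setT
    (fun u => cintegral lambda setT (fun s => (`|s| ^+ n.-1)%:C * f (tscale s u))) =
  2%:C * cintegral (leb n) setT f.
Proof.
move=> [/polar_integrable[ir Er] /polar_integrable[ii Ei]].
have ERe u : complex.Re (cintegral lambda setT (fun s => (`|s| ^+ n.-1)%:C * f (tscale s u))) =
    \int[lambda]_s (`|s| ^+ n.-1 * complex.Re (f (tscale s u))).
  by apply: eq_Rintegral => s _; rewrite complexReZ.
have EIm u : complex.Im (cintegral lambda setT (fun s => (`|s| ^+ n.-1)%:C * f (tscale s u))) =
    \int[lambda]_s (`|s| ^+ n.-1 * complex.Im (f (tscale s u))).
  by apply: eq_Rintegral => s _; rewrite complexImZ.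
split; first by split; [under eq_fun do rewrite ERe|under eq_fun do rewrite EIm].
apply: complex_ext.
  by rewrite complexReZ -Er; apply: eq_Rintegral => u _; rewrite ERe.
by rewrite complexImZ -Ei; apply: eq_Rintegral => u _; rewrite EIm.
Qed.

(** [sphere_measure] lives on all of R^n, so the vector 0 has to be discarded explicitly: a
    normalised nonzero vector has norm 1. *)
Lemma sphere_neq0 : {ae sigma, forall u : V, 0 < enorm (vec u)}.
Proof.
pose N : set V := [set u | enorm (vec u) = 0].
have mN : measurable N.
  rewrite (_ : N = (fun t : V => enorm (vec t)) @^-1` [set 0])//.
  by rewrite -[X in measurable X]setTI; exact: measurable_enorm_vec.
exists N; split => //.
- have -> : sigma N = (n%:R%:E * (leb n (set0 : set V)))%E.
    rewrite /sphere_measure /= /mscale /= /pushforward /mrestr; congr (_ * leb n _)%E.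
    apply/seteqP; split => // t [] /=; rewrite /N /= normalizeE vec_tscale enormZ.
    move=> + /andP[t0 _]; rewrite gtr0_norm ?invr_gt0// mulVf ?lt0r_neq0//.
    by move=> /eqP; rewrite oner_eq0.
  by rewrite measure0 mule0.
- move=> t /= /negP; rewrite -leNgt => e0.
  by apply/eqP; rewrite eq_le e0 enorm_ge0.
Qed.

(** Equality almost everywhere yields equal integrals for measurable functions, and nothing is known
    about [A], which will be an iterated integral. But [A] differs from [B] at most at the single
    vector 0, so it inherits measurability. *)
Lemma cintegral_sphere_eq (A B : V -> R[i]) : cintegrable sigma setT B ->
  (forall u, 0 < enorm (vec u) -> A u = B u) ->
  cintegral sigma setT A = cintegral sigma setT B.
Proof.
move=> intB AB.
pose z : V := [tuple 0 | i < n].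
have z0 u : ~~ (0 < enorm (vec u)) -> u = z.
  rewrite -leNgt => e0.
  have /enorm_eq0/rowP u0 : enorm (vec u) = 0 by apply/eqP; rewrite eq_le e0 enorm_ge0.
  by apply: eq_from_tnth => i; have := u0 i; rewrite !mxE tnth_mktuple.
have AE : A = (fun u => if 0 < enorm (vec u) then B u else A z).
  by apply/funext => u; case: ifPn => [/AB//|/z0 ->].
have [mBr mBi] := cintegrable_measurable intB.
have mpos : measurable_fun setT (fun u : V => 0 < enorm (vec u)).
  by apply: measurable_fun_ltr => //; exact: measurable_enorm_vec.
have eqR (a b : V -> R) (c : R) : measurable_fun setT b ->
    (forall u, a u = if 0 < enorm (vec u) then b u else c) ->
    \int[sigma]_u a u = \int[sigma]_u b u.
  move=> mb ab; congr fine; apply: ae_eq_integral => //.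
  - apply/measurable_EFinP; rewrite (funext ab).
    exact: measurable_fun_ifT.
  - exact/measurable_EFinP.
  - by apply: filterS sphere_neq0 => u u0 _; rewrite ab u0.
apply: complex_ext.
  by apply: (eqR _ _ (complex.Re (A z))) => // u; rewrite [in LHS]AE; case: ifP.
by apply: (eqR _ _ (complex.Im (A z))) => // u; rewrite [in LHS]AE; case: ifP.
Qed.

End complex_polar.

(** * The reconstruction formula *)

Section line.
Context {R : realType}.
Local Notation X := (measurableTypeR R).
Local Notation lambda := (@lebesgue_measure R).
Local Notation normc := (@Normc.normc R).
Implicit Types g : R -> R[i].

Definition tuple1 (x : R) : 1.-tuple X := [tuple x].

Lemma measurable_tuple1 : measurable_fun setT (tuple1 : X -> 1.-tuple X).
Proof.
apply/measurable_fun_tnthP => i; rewrite (_ : _ \o _ = id) //.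
by apply/funext => x /=; rewrite (ord1 i).
Qed.

Lemma on_line_tuple1 g x : on_line g (vec (tuple1 x)) = g x.
Proof. by rewrite /on_line mxE. Qed.

Lemma dot_tuple1 (x : 'rV[R]_1) y : dot x (vec (tuple1 y)) = x 0 0 * y.
Proof. by rewrite /dot big_ord1 mxE. Qed.

Lemma decay_tuple1 x : decay 1 (vec (tuple1 x)) = (1 + x ^+ 2)^-1.
Proof. by rewrite /decay big_ord1 mxE expr1. Qed.

Lemma cintegral_leb1 g : cintegrable lambda setT g ->
  cintegral (leb 1) setT (fun t => on_line g (vec t)) = cintegral lambda setT g.
Proof.
move=> ig; have [_] := @leb_prod R 1 (fun=> g) (fun=> ig).
rewrite big_ord1 => <-; apply: eq_cintegral => t _.
by rewrite big_ord1 /on_line mxE.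
Qed.

Lemma cintegrable_oneDsqr g K : cmeasurable (g : X -> R[i]) ->
  (forall x, normc (g x) <= K * (1 + x ^+ 2)^-1) -> cintegrable lambda setT g.
Proof.
move=> mg gK; apply: (@cintegrable_le _ _ X lambda g (fun x : R => K * (1 + x ^+ 2)^-1)) => //.
have := integrableZl measurableT K (@integrable_oneDsqrV R).
by apply: eq_integrable => // x _ /=; rewrite EFinM.
Qed.

Variables (psi : R -> R[i]) (psi_S : schwartz1 psi).

Lemma schwartz1_cmeasurable : cmeasurable (psi : X -> R[i]).
Proof.
have := cmeasurable_comp measurable_tuple1 (schwartz_cmeasurable0 psi_S).
by under eq_fun do rewrite on_line_tuple1.
Qed.

Lemma schwartz1_cintegrable : cintegrable lambda setT psi.
Proof.
have [K _ hK] := schwartz_decay0 psi_S 1.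
apply: (cintegrable_oneDsqr (K := K) schwartz1_cmeasurable) => x.
by rewrite -on_line_tuple1 -decay_tuple1.
Qed.

Lemma cintegrable_modulation1 g (r : X -> R) : measurable_fun setT r ->
  cintegrable lambda setT g -> cintegrable lambda setT (fun x => g x * expi (r x)).
Proof.
move=> mr intf; under eq_fun do rewrite mulrC.
apply: (cintegrableM_bounded (K := 1)) => //; first exact: cmeasurable_expi.
by move=> t; rewrite normc_expi.
Qed.

Lemma fourier_on_line xi : fourier psi xi = fourierRn (on_line psi) (vec (tuple1 xi)).
Proof.
rewrite /fourier /integralR -cintegral_leb1.
  by apply: eq_cintegral => t _; rewrite dot_tuple1.
apply: cintegrable_modulation1; last exact: schwartz1_cintegrable.
by apply: measurableT_comp => //; apply: measurable_funM.
Qed.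

Lemma cmeasurable_fourier : cmeasurable (fourier psi : X -> R[i]).
Proof.
have := cmeasurable_comp measurable_tuple1 (schwartz_cmeasurable_fourierRn psi_S).
by under eq_fun do rewrite -fourier_on_line.
Qed.

Lemma cintegrable_fourier : cintegrable lambda setT (fourier psi).
Proof.
have [K _ hK] := fourierRn_decay psi_S 1.
apply: (cintegrable_oneDsqr (K := K) cmeasurable_fourier) => x.
by rewrite fourier_on_line -decay_tuple1.
Qed.

Lemma fourier_inversion x :
  cintegral lambda setT (fun xi => fourier psi xi * expi (xi * x)) =
  (2 * pi)%:C * psi x.
Proof.
have := fourierRn_inversion psi_S (vec (tuple1 x)).
rewrite expr1 on_line_tuple1 => <-; rewrite -cintegral_leb1; last first.
  by apply: (cintegrable_modulation1 _ cintegrable_fourier); apply: measurable_funM.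
apply: eq_cintegral => t _; rewrite dot_tuple1 /on_line fourier_on_line.
by congr (fourierRn _ _ * _); apply/rowP => i; rewrite !mxE !ord1.
Qed.

End line.

Lemma fourierRn_bounded {R : realType} n (f : 'rV[R]_n -> R[i]) : schwartz f ->
  exists2 K : R, 0 <= K & forall w, Normc.normc (fourierRn f w) <= K.
Proof.
move=> f_S; have [K K0 hK] := fourierRn_decay f_S 1; exists K => // w.
by rewrite (le_trans (hK w))// ler_piMr ?decay_le1.
Qed.

Lemma fourier_bounded {R : realType} (g : R -> R[i]) : schwartz1 g ->
  exists2 K : R, 0 <= K & forall xi, Normc.normc (fourier g xi) <= K.
Proof.
move=> g_S; have [K K0 hK] := fourierRn_bounded g_S; exists K => // xi.
by rewrite fourier_on_line.
Qed.

(** * The integral over b for a fixed direction and a fixed scale *)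

Section reconstruction.
Context {R : realType} (n : nat).
Hypothesis n_ge2 : (2 <= n)%N.
Local Notation X := (measurableTypeR R).
Local Notation lambda := (@lebesgue_measure R).
Local Notation V := (n.-tuple X).
Local Notation normc := (@Normc.normc R).
Variables (psi eta : R -> R[i]) (chi : 'rV[R]_n -> R[i]).
Hypotheses (psi_S : schwartz1 psi) (eta_S : schwartz1 eta) (chi_S : schwartz chi).

Let psih (xi : R) := fourier psi (xi - 1).
Let etah (xi : R) := fourier eta (xi - 1).

Let c (a : R) : R := `|a| / (2 * pi) `^ (n%:R / 2).

(** The modulation e^(iy) in the atom is a unit shift in frequency: this is the origin of the
    argument xi - 1 in the constant. *)
Lemma psi_modulated (y : R) : psi y * expi y =
  ((2 * pi)^-1)%:C * cintegral lambda setT (fun xi => psih xi * expi (xi * y)).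
Proof.
have pi2 : 2 * pi != 0 :> R by rewrite lt0r_neq0// mulr_gt0// pi_gt0.
have ih : cintegrable lambda setT (fun xi => fourier psi xi * expi (xi * y)).
  by apply: (cintegrable_modulation1 _ (cintegrable_fourier psi_S)); apply: measurable_funM.
have := cintegral_affine (-1) (oner_neq0 R) ih.
rewrite normr1 invr1 mul1r fourier_inversion// => E.
have -> : cintegral lambda setT (fun xi => psih xi * expi (xi * y)) =
    expi y * ((2 * pi)%:C * psi y).
  rewrite -E -cintegralZ; last exact: (cintegrable_affine (-1) (oner_neq0 R) ih).
  apply: eq_cintegral => xi _; rewrite mul1r mulrCA -expiD; congr (_ * expi _).
  by ring.
have K : ((2 * pi)^-1)%:C * (2 * pi)%:C = 1 :> R[i] by rewrite -rmorphM mulVf.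
by rewrite mulrCA (mulrA _ _ (psi y)) K mul1r mulrC.
Qed.

Section fixed_direction.
Variables (t : V) (a : R).
Hypothesis a_neq0 : a != 0.
Let u := vec t.

(** The integrand in (b, x) of the Fourier transform of [DS eta chi] with respect to b, at the
    frequency (xi - 1) a. *)
Let G xi (p : X * V) : R[i] :=
  chi (vec p.2) * conjc (atom eta u p.1 a (vec p.2)) * expi (- ((xi - 1) * a * p.1)).

Let cmeasurable_etaE : cmeasurable (fun p : X * V => eta (a * (dot (vec p.2) u - p.1))).
Proof.
apply: (cmeasurable_comp _ (schwartz1_cmeasurable eta_S)).
apply: measurable_funM => //; apply: measurable_funB => //.
exact: (measurableT_comp (@measurable_dot_vec R n u)).
Qed.

Let cmeasurable_atom : cmeasurable (fun p : X * V => atom eta u p.1 a (vec p.2)).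
Proof.
apply: cmeasurableM; first apply: cmeasurableM => //.
apply: cmeasurable_expi; apply: measurable_funM => //.
exact: (measurableT_comp (@measurable_dot_vec R n u)).
Qed.

Let cmeasurable_G xi : cmeasurable (G xi).
Proof.
apply: cmeasurableM; first apply: cmeasurableM.
- exact: (cmeasurable_comp _ (schwartz_cmeasurable0 chi_S)).
- exact: (cmeasurable_conj cmeasurable_atom).
- apply: cmeasurable_expi; apply: measurableT_comp => //.
  exact: measurable_funM.
Qed.

Let c_ge0 : 0 <= c a.
Proof. by rewrite divr_ge0// powR_ge0. Qed.

Let oppa_neq0 : - a != 0. Proof. by rewrite oppr_eq0. Qed.

(** With b integrated first, y = a (s.u - b) leaves |a|^-1 times the L^1 norm of [eta], independent
    of the point s, and [chi] is integrable. *)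
Let cintegrable_G xi : cintegrable (lambda \x leb n)%E setT (G xi).
Proof.
apply: cintegrable_prod21 => //.
have mN := measurable_normc (schwartz1_cmeasurable eta_S).
have iN := cintegrable_normc (schwartz1_cintegrable eta_S).
have E s : (\int[lambda]_b (normc (G xi (b, s)))%:E =
    (c a * `|a|^-1 * fine (\int[lambda]_y (normc (eta y))%:E))%:E * (normc (chi (vec s)))%:E)%E.
  transitivity (\int[lambda]_b ((c a * normc (chi (vec s)))%:E *
      (normc (eta (- a * b + a * dot (vec s) u)))%:E))%E.
    apply: eq_integral => b _; rewrite /G normcM_expi Normc.normcM normc_conj.
    rewrite normcM_expi Normc.normcM normc_real ger0_norm// -EFinM; congr (_%:E).
    rewrite (_ : a * (dot (vec s) u - b) = - a * b + a * dot (vec s) u); last by ring.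
    by rewrite mulrCA mulrA.
  rewrite ge0_integralZl//; last 3 first.
  - apply/measurable_EFinP.
    exact: (measurableT_comp mN (measurable_affine (- a) (a * dot (vec s) u))).
  - by move=> b _; rewrite lee_fin normc_ge0.
  - by rewrite lee_fin mulr_ge0// normc_ge0.
  rewrite (ge0_integral_affine _ oppa_neq0 (f := fun y => (normc (eta y))%:E)); last 2 first.
  - exact/measurable_EFinP.
  - by move=> y; rewrite lee_fin normc_ge0.
  rewrite normrN -[X in (_ * (_ * X))%E]fineK; last exact: integrable_fin_num.
  by rewrite -!EFinM; congr (_%:E); ring.
under eq_integral do rewrite E.
have ichi := cintegrable_normc (schwartz_cintegrable0 chi_S).
have := integrable_fin_num measurableT (integrableZl measurableT
  (c a * `|a|^-1 * fine (\int[lambda]_y (normc (eta y))%:E)) ichi).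
by rewrite fin_numE => /andP[_]; rewrite -ltey.
Qed.

Let cintegrable_atom b :
  cintegrable (leb n) setT (fun s => chi (vec s) * conjc (atom eta u b a (vec s))).
Proof.
have [K _ etaK] := schwartz_decay0 eta_S 1.
have K0 y : normc (eta y) <= K.
  rewrite -on_line_tuple1; apply: (le_trans (etaK _)).
  rewrite ler_piMr ?decay_le1//.
  rewrite -(pmulr_lge0 _ (decay_gt0 1 (vec (tuple1 y)))).
  by rewrite (le_trans _ (etaK _))// normc_ge0.
under eq_fun do rewrite mulrC.
apply: (cintegrableM_bounded (K := c a * K)); first exact: schwartz_cintegrable0.
  have := cmeasurable_comp (pair1_measurable b) (cmeasurable_conj (cmeasurable_atom)).
  exact.
by move=> s; rewrite normc_conj normcM_expi Normc.normcM normc_real ger0_norm// ler_wpM2l.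
Qed.

Let cintegrable_DS : cintegrable lambda setT (DS eta chi u ^~ a).
Proof.
have := cintegrable_cintegral (cintegrable_G 1).
congr cintegrable; apply/funext => b; apply: eq_cintegral => s _.
by rewrite /G subrr !mul0r oppr0 expi0 mulr1.
Qed.

(** With d = s.u and y = a (d - b), the phase e^(-i a d) e^(-i (xi - 1) a b) equals e^(-i xi a d)
    e^(i (xi - 1) y). The b-integral therefore gives the conjugate transform of [eta] at xi - 1, and
    the integral over s gives the transform of [chi] at xi a u. *)
Lemma fourier_DS xi : cintegral lambda setT
    (fun b => DS eta chi u b a * expi (- ((xi - 1) * a * b))) =
  (c a * `|a|^-1)%:C * (conjc (etah xi) * fourierRn chi ((xi * a) *: u)).
Proof.
transitivity (cintegral (lambda \x leb n)%E setT (G xi)).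
  rewrite -cintegral12//; apply: eq_cintegral => b _.
  by rewrite /DS /integralRn -cintegralZr.
rewrite -cintegral21//.
pose g (y : R) : R[i] := conjc (eta y * expi (- (y * (xi - 1)))).
have ig : cintegrable lambda setT g.
  apply: cintegrable_conj; apply: (cintegrable_modulation1 _ (schwartz1_cintegrable eta_S)).
  by apply: measurableT_comp => //; apply: measurable_funM.
have ig0 : cintegral lambda setT g = conjc (etah xi).
  rewrite cintegral_conj//.
  apply: (cintegrable_modulation1 _ (schwartz1_cintegrable eta_S)).
  by apply: measurableT_comp => //; apply: measurable_funM.
have ichi w : cintegrable (leb n) setT (fun s => chi (vec s) * expi (- dot (vec s) w)).
  apply: cintegrable_modulation; last exact: schwartz_cintegrable0.
  by apply: measurableT_comp => //; exact: measurable_dot_vec.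
rewrite mulrA /fourierRn /integralRn -cintegralZ//.
apply: eq_cintegral => s _.
have E b : G xi (b, s) = ((c a)%:C * (chi (vec s) * expi (- dot (vec s) ((xi * a) *: u)))) *
    g (- a * b + a * dot (vec s) u).
  rewrite /G /g /atom /= !conjcM conjc_real !expi_conj -/(c a).
  rewrite (_ : a * (dot (vec s) u - b) = - a * b + a * dot (vec s) u); last by ring.
  set z := conjc (eta _); set d := dot (vec s) u.
  transitivity ((c a)%:C * chi (vec s) * z * (expi (- (a * d)) * expi (- ((xi - 1) * a * b)))).
    by ring.
  transitivity ((c a)%:C * chi (vec s) * z * (expi (- dot (vec s) ((xi * a) *: u)) *
     expi (- - ((- a * b + a * d) * (xi - 1))))).
    rewrite -!expiD; congr (_ * expi _).
    by rewrite [dot (vec s) (_ *: _)]dotC dotZl [dot u _]dotC -/d; ring.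
  by ring.
under eq_cintegral do rewrite E.
rewrite cintegralZ; last exact: cintegrable_affine.
rewrite cintegral_affine// ig0 normrN.
have -> : (c a * `|a|^-1)%:C = (c a)%:C * (`|a|^-1)%:C :> R[i] by rewrite -rmorphM.
by ring.
Qed.

Let H x (w : 'rV[R]_n) : R[i] := fourierRn chi w * expi (dot w x).

Lemma cintegrable_psih : cintegrable lambda setT psih.
Proof.
have := cintegrable_affine (-1) (oner_neq0 R) (cintegrable_fourier psi_S).
by under eq_fun do rewrite mul1r.
Qed.

Lemma cintegrable_M x : cintegrable lambda setT
  (fun xi => conjc (etah xi) * psih xi * H x ((xi * a) *: u)).
Proof.
have [K _ chiK] := fourierRn_bounded chi_S.
have [L L0 etaL] := fourier_bounded eta_S.
have -> : (fun xi => conjc (etah xi) * psih xi * H x ((xi * a) *: u)) =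
    (fun xi => (conjc (etah xi) * H x ((xi * a) *: u)) * psih xi).
  by apply/funext => xi; rewrite mulrAC.
apply: (cintegrableM_bounded (K := L * K)); first exact: cintegrable_psih.
  apply: cmeasurableM.
    apply: cmeasurable_conj; apply: (cmeasurable_comp _ (cmeasurable_fourier eta_S)).
    exact: measurable_funB.
  apply: cmeasurableM.
    have mts : measurable_fun setT (fun xi : X => tscale (xi * a) t).
      by apply: (@measurable_tscale _ _ _ X _ (fun=> t)) => //; exact: measurable_funM.
    have := cmeasurable_comp mts (schwartz_cmeasurable_fourierRn chi_S).
    by under eq_fun do rewrite vec_tscale.
  apply: cmeasurable_expi; under eq_fun do rewrite dotZl.
  by apply: measurable_funM => //; exact: measurable_funM.
move=> xi; rewrite Normc.normcM normc_conj normcM_expi.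
by apply: ler_pM; [exact: normc_ge0|exact: normc_ge0|exact: etaL|exact: chiK].
Qed.

(** Parseval's identity in b, obtained by expanding the atom with [psi_modulated] and exchanging b
    with xi. The constants combine as c(a)^2 |a|^-1 (2 pi)^-1 |a|^(n-2) = (2 pi)^-(n+1)
    |a|^(n-1). *)
Lemma integral_b x :
  cintegral lambda setT
    (fun b => DS eta chi u b a * atom psi u b a x * (`|a| ^+ (n - 2))%:C) =
  ((2 * pi)^-1 ^+ n.+1 * `|a| ^+ n.-1)%:C *
  cintegral lambda setT (fun xi => conjc (etah xi) * psih xi * H x ((xi * a) *: u)).
Proof.
pose g (p : X * X) : R[i] := DS eta chi u p.1 a * psih p.2 *
  expi (p.2 * (a * dot x u) - (p.2 - 1) * a * p.1).
have mg : cmeasurable g.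
  apply: cmeasurableM; first apply: cmeasurableM.
  - exact: (cmeasurable_comp _ (cintegrable_measurable cintegrable_DS)).
  - exact: (cmeasurable_comp _ (cintegrable_measurable cintegrable_psih)).
  - apply: cmeasurable_expi; apply: measurable_funB; apply: measurable_funM => //.
    by apply: measurable_funM => //; apply: measurable_funB.
have ig : cintegrable (lambda \x lambda)%E setT g.
  apply: (cintegrable_prodM_le mg (cintegrable_normc cintegrable_DS)
    (cintegrable_normc cintegrable_psih)) => b xi.
  by rewrite normcM_expi Normc.normcM.
pose k : R[i] := (c a * (2 * pi)^-1 * `|a| ^+ (n - 2))%:C.
transitivity (k * cintegral lambda setT (fun b => cintegral lambda setT (fun xi => g (b, xi)))).
  rewrite -cintegralZ; last exact: cintegrable_cintegral.
  apply: eq_cintegral => b _.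
  pose y := a * (dot x u - b).
  have iy : cintegrable lambda setT (fun xi => psih xi * expi (xi * y)).
    by apply: (cintegrable_modulation1 _ cintegrable_psih); apply: measurable_funM.
  have -> : atom psi u b a x = (c a)%:C * ((2 * pi)^-1)%:C * (expi (a * b) *
      cintegral lambda setT (fun xi => psih xi * expi (xi * y))).
    rewrite /atom -/(c a) -/y.
    have -> : expi (a * dot x u) = expi y * expi (a * b).
      by rewrite -expiD; congr expi; rewrite /y; ring.
    transitivity ((c a)%:C * (psi y * expi y) * expi (a * b)); first by ring.
    by rewrite psi_modulated; ring.
  have -> : cintegral lambda setT (fun xi => g (b, xi)) =
      DS eta chi u b a * expi (a * b) *
      cintegral lambda setT (fun xi => psih xi * expi (xi * y)).
    rewrite -cintegralZ//; apply: eq_cintegral => xi _; rewrite /g /=.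
    transitivity (DS eta chi u b a * psih xi * (expi (a * b) * expi (xi * y))).
      by rewrite -expiD; congr (_ * expi _); rewrite /y; ring.
    by ring.
  have -> : k = (c a)%:C * ((2 * pi)^-1)%:C * (`|a| ^+ (n - 2))%:C.
    by rewrite -!rmorphM.
  by ring.
rewrite cintegral12// -cintegral21//.
have EM xi : cintegral lambda setT (fun b => g (b, xi)) =
    (c a * `|a|^-1)%:C * (conjc (etah xi) * psih xi * H x ((xi * a) *: u)).
  transitivity (psih xi * expi (xi * (a * dot x u)) *
      cintegral lambda setT (fun b => DS eta chi u b a * expi (- ((xi - 1) * a * b)))).
    rewrite -cintegralZ; last first.
      apply: (cintegrable_modulation1 _ cintegrable_DS).
      have := @measurable_affine R (- ((xi - 1) * a)) 0.
      by under eq_fun do rewrite addr0 mulNr.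
    apply: eq_cintegral => b _; rewrite /g /= expiD.
    by rewrite [RHS]mulrACA; congr (_ * _); rewrite mulrC.
  rewrite fourier_DS /H dotZl [dot u x]dotC -[xi * a * dot x u]mulrA; ring.
under eq_cintegral do rewrite EM.
rewrite cintegralZ; last exact: cintegrable_M.
rewrite mulrA; congr (_ * _); rewrite -rmorphM; congr (_%:C).
have pi2 : 2 * pi != 0 :> R by rewrite lt0r_neq0// mulr_gt0// pi_gt0.
have P2 : (2 * pi) `^ (n%:R / 2) * (2 * pi) `^ (n%:R / 2) = (2 * pi) ^+ n :> R.
  rewrite -powRD; last by rewrite pi2 implybT.
  by rewrite -splitr powR_mulrn// mulr_ge0// pi_ge0.
have P0 : (2 * pi) `^ (n%:R / 2) != 0 :> R.
  by rewrite lt0r_neq0// powR_gt0// mulr_gt0// pi_gt0.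
have na0 : `|a| != 0 by rewrite normr_eq0.
(* The subtraction in n - 2 is truncated, so this identity relies on n >= 2. *)
have -> : `|a| ^+ n.-1 = `|a| * `|a| ^+ (n - 2).
  by rewrite -exprS; congr (_ ^+ _); case: (n) n_ge2 => [|[|m]]//=; rewrite subn2.
rewrite exprS exprVn -P2 /c; move: (`|a| ^+ (n - 2)) => z.
move: (_ `^ _) P0 => p p0; move: (2 * pi) pi2 => q q0.
by field; rewrite p0 q0 na0.
Qed.

End fixed_direction.
End reconstruction.

(** * Integrability along rays *)

Section rays.
Context {R : realType}.
Local Notation X := (measurableTypeR R).
Local Notation lambda := (@lebesgue_measure R).
Local Notation normc := (@Normc.normc R).

Lemma cintegral_eq_off0 (f g : R -> R[i]) :
  cmeasurable (f : X -> R[i]) -> cmeasurable (g : X -> R[i]) ->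
  (forall x, x != 0 -> f x = g x) ->
  cintegral lambda setT f = cintegral lambda setT g.
Proof.
move=> [fr fi] [gr gi] fg.
have ae0 : {ae lambda, forall x : X, x != 0 :> R}.
  exists [set (0 : X)]; split => //; first exact: lebesgue_measure_set1.
  by move=> x /= /negP; rewrite negbK => /eqP.
apply: complex_ext; congr fine; apply: ae_eq_integral => //;
  try (by apply/measurable_EFinP); apply: filterS ae0 => x x0 _ /=;
  by rewrite fg.
Qed.

Variable n : nat.
Hypothesis n_gt0 : (0 < n)%N.

(** One nonzero coordinate v_i is enough: the other factors of [decay] are at most 1, and of the n
    factors 1 + s^2 in the denominator, n - 1 absorb |s|^(n-1) and one remains. *)
Lemma decay_ray (v : 'rV[R]_n) : 0 < enorm v -> exists2 K : R, 0 <= K &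
  forall s : R, `|s| ^+ n.-1 * decay n (s *: v) <= K * (1 + s ^+ 2)^-1.
Proof.
move=> v0; have [i vi] : exists i, v 0 i != 0.
  apply/existsP; apply: contraTT v0 => /existsPn vz.
  rewrite -leNgt /enorm /dot big1 ?sqrtr0// => i _.
  by have := vz i; rewrite negbK => /eqP ->; rewrite mul0r.
(* Chosen so that d (1 + s^2) <= 1 + (s v_i)^2 for all s. *)
pose d := Num.min 1 (v 0 i ^+ 2).
have d0 : 0 < d by rewrite lt_min ltr01 exprn_even_gt0.
exists (d ^- n); first by rewrite invr_ge0 exprn_ge0// ltW.
move=> s; have s1 : 0 < 1 + s ^+ 2 by rewrite ltr_pwDl ?sqr_ge0.
have le1 : decay n (s *: v) <= ((1 + (s * v 0 i) ^+ 2) ^+ n)^-1.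
  rewrite /decay (bigD1 i)//= mxE ler_piMr ?invr_ge0 ?(ltW (decay_factor_gt0 _ _))//.
  apply: (@le_trans _ _ (\prod_(j < n | j != i) 1)); last by rewrite big1_eq.
  apply: ler_prod => j _; rewrite invr_ge0 ltW ?decay_factor_gt0//=.
  by rewrite invf_le1 ?decay_factor_gt0// exprn_ege1// lerDl sqr_ge0.
have le2 : d * (1 + s ^+ 2) <= 1 + (s * v 0 i) ^+ 2.
  have d1 : d <= 1 by rewrite ge_min lexx.
  have d2 : d <= v 0 i ^+ 2 by rewrite ge_min lexx orbT.
  rewrite mulrDr mulr1 exprMn lerD// mulrC ler_wpM2l ?sqr_ge0//.
have le3 : `|s| ^+ n.-1 <= (1 + s ^+ 2) ^+ n.-1.
  rewrite lerXn2r ?nnegrE// ?(ltW s1)//.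
  rewrite -(real_normK (num_real s)); set r := `|s|.
  by have := sqr_ge0 (r - 2^-1); nra.
have le4 : ((1 + (s * v 0 i) ^+ 2) ^+ n)^-1 <= ((d * (1 + s ^+ 2)) ^+ n)^-1.
  rewrite lef_pV2 ?posrE ?exprn_gt0// ?mulr_gt0// ?(lt_le_trans _ le2) ?mulr_gt0//.
  by rewrite lerXn2r ?nnegrE// ?ltW// ?mulr_gt0// (lt_le_trans _ le2) ?mulr_gt0.
apply: (le_trans (ler_pM _ _ le3 (le_trans le1 le4))).
- by rewrite exprn_ge0.
- by rewrite ltW// decay_gt0.
rewrite le_eqVlt; apply/orP; left; apply/eqP.
have sN0 := lt0r_neq0 s1; have dnN0 := expf_neq0 n (lt0r_neq0 d0).
rewrite (exprMn _ d) -[in (1 + s ^+ 2) ^+ n](prednK n_gt0).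
rewrite (exprS (1 + s ^+ 2)); have := expf_neq0 n.-1 sN0; move: ((1 + s ^+ 2) ^+ n.-1) => z z0.
move: (d ^+ n) dnN0 (1 + s ^+ 2) sN0 => p p0 q q0.
by field; rewrite z0 p0 q0.
Qed.

End rays.

Section reconstruction_formula.
Context {R : realType} (n : nat).
Hypothesis n_ge2 : (2 <= n)%N.
Local Notation X := (measurableTypeR R).
Local Notation lambda := (@lebesgue_measure R).
Local Notation V := (n.-tuple X).
Local Notation normc := (@Normc.normc R).
Variables (psi eta : R -> R[i]) (chi : 'rV[R]_n -> R[i]).
Hypotheses (psi_S : schwartz1 psi) (eta_S : schwartz1 eta) (chi_S : schwartz chi).
Variable x : 'rV[R]_n.

Let n_gt0 : (0 < n)%N. Proof. exact: leq_trans n_ge2. Qed.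

Let H (w : 'rV[R]_n) : R[i] := fourierRn chi w * expi (dot w x).
Let N := C_integrand n eta psi.
Hypothesis iN : cintegrable lambda setT N.

Let J (t : V) : R[i] :=
  cintegral lambda setT (fun s => (`|s| ^+ n.-1)%:C * H (vec (tscale s t))).

Let mH : cmeasurable (fun t : V => H (vec t)).
Proof.
apply: cmeasurableM; first exact: schwartz_cmeasurable_fourierRn.
by apply: cmeasurable_expi; exact: measurable_dot_vec.
Qed.

(** Polar coordinates would give this for almost every direction; the decay of the transform gives
    it for every nonzero vector, as [cintegral_sphere_eq] demands. *)
Let integrable_ray t : 0 < enorm (vec t) ->
  cintegrable lambda setT (fun s => (`|s| ^+ n.-1)%:C * H (vec (tscale s t))).
Proof.
move=> t0; have [K _ hK] := decay_ray n_gt0 t0.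
have [L L0 chiL] := fourierRn_decay chi_S n.
apply: (cintegrable_oneDsqr (K := L * K)).
  apply: cmeasurableM.
    by apply: cmeasurable_real; apply: measurable_funX.
  apply: (cmeasurable_comp _ mH).
  by apply: (@measurable_tscale _ _ _ X id (fun=> t)).
move=> s; rewrite Normc.normcM normc_real normrX normr_id normcM_expi vec_tscale.
rewrite -mulrA; apply: le_trans (ler_wpM2l L0 (hK s)).
by rewrite mulrCA ler_wpM2l ?exprn_ge0.
Qed.

Let kappa : R := (2 * pi)^-1 ^+ n.+1.

(* As [N 0 = 0] (division by zero), [N xi |xi|^n] vanishes at [xi = 0], where
   the [a]-integral of [|a|^(n-1) H (xi a u)] may diverge; so Tonelli applies. *)
Let inner_integral t : 0 < enorm (vec t) ->
  cintegral lambda [set a : R | a != 0] (fun a =>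
    integralR (fun b => DS eta chi (vec t) b a * atom psi (vec t) b a x *
      (`|a| ^+ (n - 2))%:C)) =
  kappa%:C * cintegral lambda setT N * J t.
Proof.
move=> t0.
pose g (p : X * X) : R[i] :=
  N p.2 * ((`|p.2| ^+ n * `|p.1| ^+ n.-1)%:C * H (vec (tscale (p.2 * p.1) t))).
have gE a xi : g (a, xi) =
  N xi * ((`|xi| ^+ n * `|a| ^+ n.-1)%:C * H (vec (tscale (xi * a) t))) by [].
have mg : cmeasurable g.
  apply: cmeasurableM; first exact: (cmeasurable_comp _ (cintegrable_measurable iN)).
  apply: cmeasurableM.
    apply: cmeasurable_real; apply: measurable_funM; apply: measurable_funX;
      exact: measurableT_comp.
  apply: (cmeasurable_comp _ mH).
  by apply: (@measurable_tscale _ _ _ (X * X)%type _ (fun=> t)) => //; exact: measurable_funM.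
pose F (s : R) : R[i] := (`|s| ^+ n.-1)%:C * H (vec (tscale s t)).
have iJ : cintegrable lambda setT F := integrable_ray t0.
have N0 : N 0 = 0.
  by rewrite /N /C_integrand normr0 expr0n gtn_eqF// invr0 mulr0.
have ci0 : cintegral lambda setT (fun=> 0 : R[i]) = 0.
  by apply: complex_ext; rewrite /cintegral /Rintegral /= integral0.
(* |xi|^n |a|^(n-1) = |xi| |xi a|^(n-1): the isolated factor |xi| cancels the Jacobian of s = xi
   a. *)
have Er (xi a : R) : xi != 0 -> (`|xi| ^+ n * `|a| ^+ n.-1)%:C * H (vec (tscale (xi * a) t)) =
    `|xi|%:C * F (xi * a + 0).
  move=> xi0; rewrite /F addr0 mulrA; congr (_ * _).
  rewrite -rmorphM; congr (_%:C).
  by rewrite normrM exprMn mulrA -exprS prednK.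
have ig : cintegrable (lambda \x lambda)%E setT g.
  apply: cintegrable_prod21 => //.
  have inJ := cintegrable_normc iJ.
  have E xi : (\int[lambda]_a (normc (g (a, xi)))%:E =
      (normc (N xi) * fine (\int[lambda]_s (normc (F s))%:E))%:E)%E.
    have [->|xi0] := eqVneq xi 0.
      rewrite N0 Normc.normc0 mul0r; apply: integral0_eq => a _.
      by rewrite gE N0 mul0r Normc.normc0.
    transitivity (\int[lambda]_a ((normc (N xi) * `|xi|)%:E * (normc (F (xi * a + 0)))%:E))%E.
      apply: eq_integral => a _; rewrite gE Er// !Normc.normcM normc_real normr_id.
      by rewrite -EFinM mulrA.
    rewrite ge0_integralZl//; last 3 first.
    - apply/measurable_EFinP.
      exact: (measurableT_comp (measurable_normc (cintegrable_measurable iJ))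
        (measurable_affine xi 0)).
    - by move=> a _; rewrite lee_fin normc_ge0.
    - by rewrite lee_fin mulr_ge0// normc_ge0.
    rewrite (ge0_integral_affine _ xi0 (f := fun s => (normc (F s))%:E)); last 2 first.
    - exact/measurable_EFinP/measurable_normc/(cintegrable_measurable iJ).
    - by move=> s; rewrite lee_fin normc_ge0.
    rewrite -[X in (_ * (_ * X))%E]fineK; last exact: integrable_fin_num.
    by rewrite -!EFinM mulrA mulfK// normr_eq0.
  under eq_integral do rewrite E.
  have := integrable_fin_num measurableT (integrableZr measurableT
    (fine (\int[lambda]_s (normc (F s))%:E)) (cintegrable_normc iN)).
  by rewrite fin_numE => /andP[_]; rewrite -ltey.
have gxi xi : cintegral lambda setT (fun a => g (a, xi)) = N xi * J t.
  have [->|xi0] := eqVneq xi 0.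
    by rewrite N0 mul0r -[RHS]ci0; apply: eq_cintegral => a _; rewrite gE N0 mul0r.
  under eq_cintegral do rewrite gE Er// mulrA.
  rewrite cintegralZ; last exact: cintegrable_affine.
  rewrite cintegral_affine// -mulrA; congr (_ * _).
  rewrite mulrA (_ : `|xi|%:C * (`|xi|^-1)%:C = 1) ?mul1r//.
  by rewrite -rmorphM mulfV// normr_eq0.
transitivity (cintegral lambda setT (fun a =>
    kappa%:C * cintegral lambda setT (fun xi => g (a, xi)))).
  (* At a = 0 the excluded value matches the right-hand side, because |a|^(n-1) = 0 for n >= 2. *)
  have E a : (if a != 0 then integralR (fun b => DS eta chi (vec t) b a *
        atom psi (vec t) b a x * (`|a| ^+ (n - 2))%:C) else 0) =
      kappa%:C * cintegral lambda setT (fun xi => g (a, xi)).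
    case: ifPn => [a0|]; last first.
      rewrite negbK => /eqP ->; rewrite (_ : cintegral _ _ _ = 0) ?mulr0// -[RHS]ci0.
      apply: eq_cintegral => xi _; rewrite gE normr0 expr0n.
      rewrite (_ : (n.-1 == 0)%N = false) ?mulr0 ?mul0r ?mulr0//.
      by case: (n) n_ge2 => [|[]].
    rewrite /integralR integral_b// rmorphM -mulrA; congr (_ * _).
    rewrite -cintegralZ; last exact: cintegrable_M.
    (* At xi = 0 the cancellation of |xi|^n against its inverse fails, so the integrands are
       compared only off this point. *)
    apply: cintegral_eq_off0.
    - apply: cmeasurableM; first exact: cmeasurable_cst.
      exact: (cintegrable_measurable (cintegrable_M psi_S eta_S chi_S t a x)).
    - exact: (cmeasurable_comp (pair1_measurable a) mg).
    - move=> xi xi0; rewrite gE /N /C_integrand vec_tscale /H rmorphM.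
      set M := _ * fourier psi _; set h := fourierRn _ _ * _.
      transitivity (M * (((`|xi| ^+ n)%:C^-1 * (`|xi| ^+ n)%:C) *
          (`|a| ^+ n.-1)%:C * h)); last by ring.
      rewrite mulVf; last first.
        apply/eqP => /(congr1 (@complex.Re R))/= /eqP.
        by rewrite expf_eq0 normr_eq0 (negbTE xi0) andbF.
      by rewrite mul1r mulrCA.
  rewrite cintegral_mkcond; apply: eq_cintegral => a _.
  by rewrite -E mem_setE.
rewrite cintegralZ; last exact: cintegrable_cintegral.
rewrite cintegral12// -cintegral21//; under eq_cintegral do rewrite gxi.
by rewrite cintegralZr// mulrA.
Qed.

Theorem DSadj_DS : DSadj psi (DS eta chi) x = C_const n eta psi * chi x.
Proof.
have iH : cintegrable (leb n) setT (fun t : V => H (vec t)).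
  exact: cintegrable_fourierRn.
have [iJ EJ] := cpolar n_ge2 iH.
rewrite /DSadj /integralS.
rewrite (cintegral_sphere_eq (B := fun t => kappa%:C * cintegral lambda setT N * J t)).
- rewrite cintegralZ// EJ.
  have -> : cintegral (leb n) setT (fun t : V => H (vec t)) = ((2 * pi) ^+ n)%:C * chi x.
    exact: fourierRn_inversion.
  rewrite /C_const /integralR -/N.
  have -> : kappa%:C * cintegral lambda setT N * (2%:C * (((2 * pi) ^+ n)%:C * chi x)) =
     (kappa%:C * 2%:C * ((2 * pi) ^+ n)%:C) * (cintegral lambda setT N * chi x) by ring.
  (* The constants reduce to (2 pi)^-(n+1) * 2 * (2 pi)^n = 1 / pi, the normalisation in
     [C_const]. *)
  rewrite -[RHS]mulrA; congr (_ * _); rewrite -!rmorphM; congr (_%:C).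
  rewrite /kappa exprS exprVn; have := lt0r_neq0 (pi_gt0 R).
  move: (pi : R) => p p0; have p20 : 2 * p != 0 by rewrite mulf_neq0.
  have := expf_neq0 n p20.
  move: ((2 * p) ^+ n) => q q0.
  by field; rewrite p0 q0.
- exact: cintegrableZ.
- exact: inner_integral.
Qed.

End reconstruction_formula.

(** * Complex conjugation and the passage to distributions *)

Section conjugation.
Context {R : realType} (n : nat).
Implicit Type f : 'rV[R]_n -> R[i].

Lemma foldr_partial_conj f s : smooth f ->
  foldr (@partial R n) (fun x => conjc (f x)) s =
  (fun x => conjc (foldr (@partial R n) f s x)).
Proof.
move=> f_smooth; elim: s => //= i s ->; apply/funext => x; rewrite /partial.
under [X in 'D__ X x +i* _]eq_fun do rewrite complexRe_conj.
under [X in _ +i* 'D__ X x]eq_fun do rewrite complexIm_conj.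
rewrite /=; congr (_ +i* _); rewrite deriveN//; apply: diff_derivable.
exact: (f_smooth s x).2.
Qed.

Lemma schwartz_conj f : schwartz f -> schwartz (fun x => conjc (f x)).
Proof.
move=> [f_smooth f_decay]; split.
  move=> s x; rewrite foldr_partial_conj//; split.
    by under eq_fun do rewrite complexRe_conj; exact: (f_smooth s x).1.
  under eq_fun do rewrite complexIm_conj.
  by apply: differentiableN; exact: (f_smooth s x).2.
move=> alpha beta; have := f_decay alpha beta; congr (_ < _)%E.
rewrite /schwartz_seminorm; congr ereal_sup.
have [s E] := @multi_partial_foldr R n beta.
rewrite !E foldr_partial_conj//; apply/seteqP.
by split => _ [x _ <-]; exists x => //; rewrite normc_conj.
Qed.

End conjugation.

(** Transposition makes [eta] the analysing and [psi] the synthesising window; this identity relates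
    the resulting constant to the one in the claim. *)
Lemma C_integrand_conj {R : realType} n (psi eta : R -> R[i]) xi :
  C_integrand n eta psi xi = conjc (C_integrand n psi eta xi).
Proof.
rewrite /C_integrand -[_ / _]/(_ * _) !conjcM conjcK [X in _ = X * _]mulrC.
by congr (_ * _); rewrite -fmorphV conjc_real.
Qed.

Theorem proposition5p4 (R : realType) (n : nat) (n_ge2 : (2 <= n)%N)
  (psi eta : R -> R[i]) (psi_S1 : S1 psi) (psi_neq0 : exists x, psi x != 0)
  (eta_S1 : S1 eta) (eta_window : reconstruction_window n psi eta)
  (f : ('rV[R]_n -> R[i]) -> R[i]) (f_dual : lizorkin_dual f)
  (phi : 'rV[R]_n -> R[i]) (phi_S0 : lizorkin phi) :
  (C_const n psi eta)^-1 * DSadj_dual eta (DS_dual psi f) phi = f phi.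
Proof.
have [eta_S iC C0] := eta_window.
have CE : C_const n eta psi = conjc (C_const n psi eta).
  rewrite [RHS]conjcM conjc_real; congr (_ * _); rewrite -(cintegral_conj iC).
  by apply: eq_cintegral => xi _; rewrite C_integrand_conj.
have iC' : cintegrable (@lebesgue_measure R) setT (C_integrand n eta psi).
  rewrite (_ : C_integrand n eta psi = fun xi => conjc (C_integrand n psi eta xi)).
    exact: cintegrable_conj.
  by apply/funext => xi; rewrite C_integrand_conj.
rewrite /DSadj_dual /DS_dual.
set g := (X in f X).
(* Linearity of [f] is given for combinations c phi + chi, so the multiple C phi is written as (C -
   1) phi + phi. *)
have -> : g = (fun x => (C_const n psi eta - 1) * phi x + phi x).
  apply/funext => x; rewrite /g.
  rewrite (_ : (fun u b a => conjc (conjc _)) = DS eta (fun x => conjc (phi x))).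
    rewrite (DSadj_DS n_ge2 psi_S1.1 eta_S1.1 (schwartz_conj phi_S0.1) _ iC').
    by rewrite CE conjcM !conjcK mulrBl mul1r subrK.
  by apply/funext => u; apply/funext => b; apply/funext => a; rewrite conjcK.
rewrite (f_dual.1 _ _ _ phi_S0 phi_S0) mulrBl mul1r subrK.
by rewrite mulKf.
Qed.
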